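(* Let $\omega_1,\omega_2\in\mathbb C$ be nonzero with $\omega_1/\omega_2\notin\mathbb R$, let $\Lambda=\{a\omega_1+b\omega_2: a,b\in\mathbb Z\}$, and let $\wp$ be the Weierstrass $\wp$-function of $\Lambda$ and $\wp'$ its derivative. For all $z,w\in\mathbb C$ with $z,w,z+w\notin\Lambda$ and $\wp(z)\neq\wp(w)$, $$\wp(w+z)=\frac14\left(\frac{\wp'(z)-\wp'(w)}{\wp(z)-\wp(w)}\right)^2-\wp(z)-\wp(w).$$
   Context: The Weierstrass $\wp$-function of $\Lambda$ is the meromorphic function $\wp(z)=\frac{1}{z^2}+\sum_{\omega\in\Lambda\setminus\{0\}}\left(\frac{1}{(z+\omega)^2}-\frac{1}{\omega^2}\right)$ on $\mathbb C$, whose poles are exactly the points of $\Lambda$. *)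

(* Defs.v *)
From Stdlib Require Import Reals ZArith List.
From Coquelicot Require Import Coquelicot.

Open Scope C_scope.

Definition lattice (w1 w2 : C) : C -> Prop :=
  fun u => exists a b : Z, u = IZR a * w1 + IZR b * w2.

(* Finite subsets of [A] are represented by duplicate-free lists. *)
Definition finite_subset {I : Type} (A : I -> Prop) (l : list I) : Prop :=
  NoDup l /\ forall x, In x l -> A x.

Definition list_sum {I : Type} (f : I -> C) (l : list I) : C :=
  fold_right Cplus 0 (map f l).

(* Unconditional summation over an arbitrary index set: convergence of the net
   of finite partial sums, ordered by inclusion. *)
Definition is_unordered_sum {I : Type} (A : I -> Prop) (f : I -> C) (s : C) :
    Prop :=
  forall eps : posreal, exists l0, finite_subset A l0 /\
    forall l, finite_subset A l -> incl l0 l ->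
      (Cmod (list_sum f l - s) < eps)%R.

(* [iota] picks the unique sum; the value is unspecified for a non-summable
   family. *)
Definition unordered_sum {I : Type} (A : I -> Prop) (f : I -> C) : C :=
  iota (T := C_CompleteNormedModule) (is_unordered_sum A f).

(* At a point of [L] the value is irrelevant (Coquelicot's division by 0 is
   total); elsewhere no denominator vanishes. *)
Definition weierstrass_p (L : C -> Prop) (z : C) : C :=
  1 / z ^ 2 +
  unordered_sum (fun w => L w /\ w <> 0)
    (fun w => 1 / (z + w) ^ 2 - 1 / w ^ 2).

(* [C_derive] takes the limit of the difference quotient along real increments;
   it is the complex derivative at every point where the function is complex
   differentiable ([C_derive_correct]). *)
Definition weierstrass_p' (L : C -> Prop) : C -> C :=
  C_derive (weierstrass_p L).

(* Main.v *)
(* Put S = ζ(z+w) - ζ(z) - ζ(w), where ζ' = -℘. For fixed w the function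
   S^2 - ℘(z+w) - ℘(z) - ℘(w) of z is doubly periodic and invariant under
   z -> -(z+w), and its poles at 0 cancel, leaving the value 0; so it is entire
   and bounded, hence 0 by Liouville's theorem. Differentiating
   S^2 = ℘(z+w) + ℘(z) + ℘(w) in z and in w and subtracting gives
   2 S (℘(z) - ℘(w)) = ℘'(z) - ℘'(w), which eliminates S.

   Regularity of all the functions is read off the absolutely convergent series
   E3(a,b,c) = sum 1/((a+x)(b+x)(c+x)), which is jointly continuous: it is, up to
   sign, the difference quotient in u of
   D0(u,v) = sum (1/((u+x)(v+x)) - 1/x^2), and in turn ℘(u) = 1/u^2 + D0(u,u)
   and ζ(u) = 1/u - u D0(u,0). *)
From Stdlib Require Import Reals ZArith List Lra Lia Classical ClassicalEpsilon FinFun.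
From Coquelicot Require Import Coquelicot.
Require Import Defs.
Open Scope C_scope.

(** * Unordered sums *)

(** The substitution z -> -(z+w) exchanges the two classes of poles, Λ and -w+Λ, so a single local
    computation at 0 removes every singularity. It is an algebraic cancellation: near 0 the function
    is rewritten in terms of convergent series, which are regular there, and no theorem on removable
    singularities enters. ζ is not periodic, since each period adds a constant; but these constants
    cancel in ζ(z+w) - ζ(z), so only differences of ζ ever have to be translated. Liouville's
    theorem comes from means over circles. For bounded f, the integral over t of Re(exp(-it) f(z0 +
    r exp(it))) is proportional to r for r > 0, hence zero there by boundedness, while its
    derivative at r = 0 is 2π Re f'(z0). The same for -i f gives f' = 0. *)

Definition rsum {I : Type} (g : I -> R) (l : list I) : R :=
  fold_right Rplus 0%R (map g l).

Lemma rsum_app {I : Type} (g : I -> R) (l l' : list I) :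
  rsum g (l ++ l') = (rsum g l + rsum g l')%R.
Proof.
  induction l as [|x l IH]; unfold rsum in *; simpl; [|rewrite IH]; ring.
Qed.

Lemma rsum_nonneg {I : Type} (g : I -> R) (l : list I) :
  (forall x, In x l -> (0 <= g x)%R) -> (0 <= rsum g l)%R.
Proof.
  unfold rsum; induction l as [|x l IH]; simpl; intros H; [lra|].
  assert (H1 := H x (or_introl eq_refl)).
  assert (H2 := IH (fun y Hy => H y (or_intror Hy))). lra.
Qed.

Lemma rsum_le {I : Type} (g h : I -> R) (l : list I) :
  (forall x, In x l -> (g x <= h x)%R) -> (rsum g l <= rsum h l)%R.
Proof.
  unfold rsum; induction l as [|x l IH]; simpl; intros H; [lra|].
  assert (H1 := H x (or_introl eq_refl)).
  assert (H2 := IH (fun y Hy => H y (or_intror Hy))). lra.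
Qed.

Lemma rsum_scal {I : Type} (c : R) (g : I -> R) (l : list I) :
  rsum (fun x => c * g x)%R l = (c * rsum g l)%R.
Proof.
  unfold rsum; induction l as [|x l IH]; simpl; [|rewrite IH]; ring.
Qed.

Lemma rsum_incl {I : Type} (g : I -> R) (l l' : list I) :
  NoDup l -> incl l l' -> (forall x, In x l' -> (0 <= g x)%R) ->
  (rsum g l <= rsum g l')%R.
Proof.
  intros Hl; revert l'; induction Hl as [|x l Hx Hl IH]; intros l' Hincl Hg.
  - now apply rsum_nonneg.
  - destruct (in_split x l' (Hincl x (or_introl eq_refl))) as [l1 [l2 ->]].
    assert (H : (rsum g l <= rsum g (l1 ++ l2))%R).
    { apply IH.
      - intros y Hy.
        assert (Hy' := Hincl y (or_intror Hy)).
        apply in_app_or in Hy'; apply in_or_app.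
        destruct Hy' as [Hy'|[<-|Hy']]; tauto.
      - intros y Hy; apply Hg; apply in_app_or in Hy; apply in_or_app.
        simpl; tauto. }
    rewrite rsum_app in H |- *.
    change (rsum g (x :: l)) with (g x + rsum g l)%R.
    change (rsum g (x :: l2)) with (g x + rsum g l2)%R. lra.
Qed.

Lemma list_sum_RtoC {I : Type} (g : I -> R) (l : list I) :
  list_sum (fun x => RtoC (g x)) l = RtoC (rsum g l).
Proof.
  unfold list_sum, rsum; induction l as [|x l IH]; simpl; [easy|].
  now rewrite IH, RtoC_plus.
Qed.

Lemma list_sum_plus {I : Type} (f g : I -> C) (l : list I) :
  list_sum (fun x => f x + g x) l = list_sum f l + list_sum g l.
Proof.
  unfold list_sum; induction l as [|x l IH]; simpl; [|rewrite IH]; ring.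
Qed.

Lemma list_sum_scal {I : Type} (c : C) (f : I -> C) (l : list I) :
  list_sum (fun x => c * f x) l = c * list_sum f l.
Proof.
  unfold list_sum; induction l as [|x l IH]; simpl; [|rewrite IH]; ring.
Qed.

Lemma list_sum_ext {I : Type} (f g : I -> C) (l : list I) :
  (forall x, In x l -> f x = g x) -> list_sum f l = list_sum g l.
Proof.
  intros H; unfold list_sum; f_equal; now apply map_ext_in.
Qed.

Lemma Cmod_list_sum {I : Type} (f : I -> C) (g : I -> R) (l : list I) :
  (forall x, In x l -> (Cmod (f x) <= g x)%R) ->
  (Cmod (list_sum f l) <= rsum g l)%R.
Proof.
  unfold list_sum, rsum; induction l as [|x l IH]; simpl; intros H.
  - rewrite Cmod_0; lra.
  - eapply Rle_trans; [apply Cmod_triangle|].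
    apply Rplus_le_compat; [|apply IH]; intros; apply H; tauto.
Qed.

Lemma finite_subset_union {I : Type} (A : I -> Prop) (l1 l2 : list I) :
  finite_subset A l1 -> finite_subset A l2 ->
  exists l, finite_subset A l /\ incl l1 l /\ incl l2 l.
Proof.
  intros [_ H1] [_ H2].
  assert (dec : forall x y : I, {x = y} + {x <> y})
    by (intros; apply excluded_middle_informative).
  exists (nodup dec (l1 ++ l2)); repeat split.
  - apply NoDup_nodup.
  - intros x Hx; apply nodup_In, in_app_or in Hx; destruct Hx; auto.
  - intros x Hx; apply nodup_In, in_or_app; auto.
  - intros x Hx; apply nodup_In, in_or_app; auto.
Qed.

Lemma is_unordered_sum_unique {I : Type} (A : I -> Prop) (f : I -> C) (s t : C) :
  is_unordered_sum A f s -> is_unordered_sum A f t -> s = t.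
Proof.
  intros Hs Ht.
  destruct (Req_dec (Cmod (s - t)) 0) as [H|H].
  { apply Cmod_eq_0 in H. replace s with (s - t + t) by ring. rewrite H; ring. }
  assert (Hpos : (0 < Cmod (s - t) / 2)%R) by (generalize (Cmod_ge_0 (s - t)); lra).
  destruct (Hs (mkposreal _ Hpos)) as [l1 [F1 H1]].
  destruct (Ht (mkposreal _ Hpos)) as [l2 [F2 H2]].
  destruct (finite_subset_union A l1 l2 F1 F2) as [l [F [I1 I2]]].
  specialize (H1 l F I1); specialize (H2 l F I2); simpl in H1, H2.
  assert (H3 : (Cmod (s - t)
      <= Cmod (list_sum f l - t) + Cmod (list_sum f l - s))%R).
  { rewrite <- (Cmod_opp (list_sum f l - s)).
    replace (s - t) with (list_sum f l - t + - (list_sum f l - s)) by ring.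
    apply Cmod_triangle. }
  lra.
Qed.

Lemma unordered_sum_eq {I : Type} (A : I -> Prop) (f : I -> C) (s : C) :
  is_unordered_sum A f s -> unordered_sum A f = s.
Proof.
  intros H; apply (iota_unique (V := C_CompleteNormedModule)); [|exact H].
  intros t Ht; exact (is_unordered_sum_unique A f t s Ht H).
Qed.

Lemma is_unordered_sum_ext {I : Type} (A : I -> Prop) (f g : I -> C) (s : C) :
  (forall x, A x -> f x = g x) ->
  is_unordered_sum A f s -> is_unordered_sum A g s.
Proof.
  intros Hfg Hf eps; destruct (Hf eps) as [l0 [F0 H0]].
  exists l0; split; [exact F0|]; intros l F Hl.
  rewrite <- (list_sum_ext f g); [now apply H0|].
  intros x Hx; apply Hfg, F, Hx.
Qed.

Lemma is_unordered_sum_plus {I : Type} (A : I -> Prop) (f g : I -> C) (s t : C) :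
  is_unordered_sum A f s -> is_unordered_sum A g t ->
  is_unordered_sum A (fun x => f x + g x) (s + t).
Proof.
  intros Hf Hg eps.
  destruct (Hf (pos_div_2 eps)) as [l1 [F1 H1]].
  destruct (Hg (pos_div_2 eps)) as [l2 [F2 H2]].
  destruct (finite_subset_union A l1 l2 F1 F2) as [l0 [F0 [I1 I2]]].
  exists l0; split; [exact F0|]; intros l F Hl.
  specialize (H1 l F (incl_tran I1 Hl)); specialize (H2 l F (incl_tran I2 Hl)).
  simpl in H1, H2; rewrite list_sum_plus.
  replace (list_sum f l + list_sum g l - (s + t))
    with (list_sum f l - s + (list_sum g l - t)) by ring.
  eapply Rle_lt_trans; [apply Cmod_triangle|]; lra.
Qed.

Lemma is_unordered_sum_scal {I : Type} (A : I -> Prop) (c : C) (f : I -> C) (s : C) :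
  is_unordered_sum A f s -> is_unordered_sum A (fun x => c * f x) (c * s).
Proof.
  intros Hf eps.
  assert (Hc : (0 < Cmod c + 1)%R) by (generalize (Cmod_ge_0 c); lra).
  assert (Hpos : (0 < eps / (Cmod c + 1))%R)
    by (apply Rdiv_lt_0_compat; [apply cond_pos|exact Hc]).
  destruct (Hf (mkposreal _ Hpos)) as [l0 [F0 H0]].
  exists l0; split; [exact F0|]; intros l F Hl.
  specialize (H0 l F Hl); simpl in H0.
  rewrite list_sum_scal.
  replace (c * list_sum f l - c * s) with (c * (list_sum f l - s)) by ring.
  rewrite Cmod_mult.
  apply (Rmult_lt_compat_l _ _ _ Hc) in H0.
  replace ((Cmod c + 1) * (eps / (Cmod c + 1)))%R with (pos eps) in H0
    by (field; lra).
  generalize (Cmod_ge_0 (list_sum f l - s)); lra.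
Qed.

Lemma is_unordered_sum_opp {I : Type} (A : I -> Prop) (f : I -> C) (s : C) :
  is_unordered_sum A f s -> is_unordered_sum A (fun x => - f x) (- s).
Proof.
  intros Hf; replace (- s) with (RtoC (-1) * s) by ring.
  eapply is_unordered_sum_ext; [|apply (is_unordered_sum_scal A (RtoC (-1)) f s Hf)].
  intros x _; simpl; ring.
Qed.

Lemma is_unordered_sum_minus {I : Type} (A : I -> Prop) (f g : I -> C) (s t : C) :
  is_unordered_sum A f s -> is_unordered_sum A g t ->
  is_unordered_sum A (fun x => f x - g x) (s - t).
Proof.
  intros Hf Hg; exact (is_unordered_sum_plus A _ _ _ _ Hf (is_unordered_sum_opp A _ _ Hg)).
Qed.

Lemma Cmod_unordered_sum_le {I : Type} (A : I -> Prop) (f : I -> C) (g : I -> R)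
    (s : C) (M : R) :
  (forall x, A x -> (Cmod (f x) <= g x)%R) ->
  (forall l, finite_subset A l -> (rsum g l <= M)%R) ->
  is_unordered_sum A f s -> (Cmod s <= M)%R.
Proof.
  intros Hfg HM Hs; apply Rnot_lt_le; intros Hlt.
  assert (Hpos : (0 < Cmod s - M)%R) by lra.
  destruct (Hs (mkposreal _ Hpos)) as [l [F H]].
  specialize (H l F (incl_refl l)); simpl in H.
  assert (H1 : (Cmod (list_sum f l) <= rsum g l)%R)
    by (apply Cmod_list_sum; intros x Hx; apply Hfg, F, Hx).
  specialize (HM l F).
  assert (H2 : (Cmod s <= Cmod (list_sum f l) + Cmod (list_sum f l - s))%R).
  { rewrite <- (Cmod_opp (list_sum f l - s)).
    replace s with (list_sum f l + - (list_sum f l - s)) at 1 by ring.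
    apply Cmod_triangle. }
  lra.
Qed.

(** The sum is the supremum of the finite partial sums: enlarging the index set never decreases
    them, so beyond one that is within [eps] of the supremum all stay within [eps]. *)
Lemma summable_nonneg {I : Type} (A : I -> Prop) (g : I -> R) (M : R) :
  (forall x, A x -> (0 <= g x)%R) ->
  (forall l, finite_subset A l -> (rsum g l <= M)%R) ->
  exists s, is_unordered_sum A (fun x => RtoC (g x)) s.
Proof.
  intros Hg HM.
  destruct (completeness (fun r => exists l, finite_subset A l /\ r = rsum g l))
    as [s [Hub Hlub]].
  - exists M; intros r [l [F ->]]; auto.
  - exists 0%R, nil; split; [|easy]; split; [constructor|easy].
  - exists (RtoC s); intros eps.
    destruct (classic (exists l0, finite_subset A l0 /\ (s - eps < rsum g l0)%R))
      as [[l0 [F0 H0]]|Hno].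
    + exists l0; split; [exact F0|]; intros l F Hl.
      rewrite list_sum_RtoC, <- RtoC_minus, Cmod_R.
      assert (H1 : (rsum g l0 <= rsum g l)%R)
        by (apply rsum_incl; [apply F0|exact Hl|intros x Hx; apply Hg, F, Hx]).
      assert (H2 : (rsum g l <= s)%R) by (apply Hub; exists l; easy).
      apply Rabs_def1; generalize (cond_pos eps); lra.
    + exfalso.
      assert (H : (s <= s - eps)%R).
      { apply Hlub; intros r [l [F ->]]; apply Rnot_lt_le; intros Hlt.
        apply Hno; now exists l. }
      generalize (cond_pos eps); lra.
Qed.

(** A real family [h] with [|h| <= g] is the difference of the nonnegative families [h + g] and [g],
    whose finite sums stay below [2 * M] and [M]. Real and imaginary parts then give the complex
    case. *)
Lemma summable_dominated {I : Type} (A : I -> Prop) (f : I -> C) (g : I -> R)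
    (M : R) :
  (forall x, A x -> (Cmod (f x) <= g x)%R) ->
  (forall l, finite_subset A l -> (rsum g l <= M)%R) ->
  exists s, is_unordered_sum A f s.
Proof.
  intros Hfg HM.
  assert (Hreal : forall h : I -> R, (forall x, A x -> (Rabs (h x) <= g x)%R) ->
            exists s, is_unordered_sum A (fun x => RtoC (h x)) s).
  { intros h Hh.
    assert (Hb : forall x, A x -> (- g x <= h x <= g x)%R)
      by (intros x Hx; apply Rabs_le_between, Hh, Hx).
    destruct (summable_nonneg A g M) as [s Hs]; [|exact HM|].
    { intros x Hx; specialize (Hb x Hx); lra. }
    destruct (summable_nonneg A (fun x => h x + g x)%R (2 * M)) as [t Ht].
    { intros x Hx; specialize (Hb x Hx); lra. }
    { intros l F.
      apply Rle_trans with (rsum (fun x => 2 * g x)%R l).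
      - apply rsum_le; intros x Hx; specialize (Hb x (proj2 F x Hx)); lra.
      - rewrite rsum_scal; specialize (HM l F); lra. }
    exists (t - s).
    eapply is_unordered_sum_ext; [|exact (is_unordered_sum_minus A _ _ _ _ Ht Hs)].
    intros x _; simpl; rewrite RtoC_plus; ring. }
  destruct (Hreal (fun x => Re (f x))) as [s Hs].
  { intros x Hx; eapply Rle_trans; [apply re_le_Cmod|auto]. }
  destruct (Hreal (fun x => Im (f x))) as [t Ht].
  { intros x Hx; eapply Rle_trans; [|apply Hfg, Hx].
    eapply Rle_trans; [|apply Rmax_Cmod]; apply Rmax_r. }
  exists (s + Ci * t).
  eapply is_unordered_sum_ext;
    [|exact (is_unordered_sum_plus A _ _ _ _ Hs (is_unordered_sum_scal A Ci _ _ Ht))].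
  intros x _; simpl; destruct (f x) as [a b].
  unfold Cplus, Cmult, RtoC, Ci, Re, Im; simpl; f_equal; ring.
Qed.

Lemma is_unordered_sum_reindex {I : Type} (A : I -> Prop) (f : I -> C) (s : C)
    (phi psi : I -> I) :
  (forall x, A x -> A (phi x)) -> (forall x, A x -> A (psi x)) ->
  (forall x, phi (psi x) = x) -> (forall x, psi (phi x) = x) ->
  is_unordered_sum A f s -> is_unordered_sum A (fun x => f (phi x)) s.
Proof.
  intros Hphi Hpsi H1 H2 Hs eps; destruct (Hs eps) as [l0 [[N0 A0] H0]].
  assert (Hnd : forall (h k : I -> I) (l : list I),
            (forall x, k (h x) = x) -> NoDup l -> NoDup (map h l)).
  { intros h k l Hkh Hl; apply Injective_map_NoDup; [|exact Hl].
    intros x y Hxy; rewrite <- (Hkh x), <- (Hkh y); congruence. }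
  exists (map psi l0); repeat split.
  - now apply (Hnd psi phi).
  - intros x Hx; apply in_map_iff in Hx; destruct Hx as [y [<- Hy]]; auto.
  - intros l [N B] Hl.
    replace (list_sum (fun x => f (phi x)) l) with (list_sum f (map phi l))
      by (unfold list_sum; now rewrite map_map).
    apply H0; [split|].
    + now apply (Hnd phi psi).
    + intros x Hx; apply in_map_iff in Hx; destruct Hx as [y [<- Hy]]; auto.
    + intros x Hx; rewrite <- (H1 x); now apply in_map, Hl, in_map.
Qed.

(** Lets the lattice point [0] join the sums over nonzero lattice points: translation by a period
    preserves only the whole lattice. *)
Lemma is_unordered_sum_insert {I : Type} (A B : I -> Prop) (a : I) (f : I -> C)
    (s : C) :
  A a -> (forall x, B x <-> A x /\ x <> a) ->
  is_unordered_sum B f s -> is_unordered_sum A f (s + f a).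
Proof.
  intros Ha HB Hs eps; destruct (Hs eps) as [l0 [[N0 B0] H0]].
  assert (dec : forall x y : I, {x = y} + {x <> y})
    by (intros; apply excluded_middle_informative).
  exists (a :: l0); repeat split.
  - constructor; [|exact N0]. intros Hin; now apply B0, HB in Hin.
  - intros x [<-|Hx]; [exact Ha|]. now apply HB, B0.
  - intros l [N HA] Hl.
    destruct (in_split a l (Hl a (or_introl eq_refl))) as [l1 [l2 ->]].
    assert (Hsum : list_sum f (l1 ++ a :: l2) = list_sum f (l1 ++ l2) + f a).
    { unfold list_sum; rewrite !map_app; simpl.
      induction (map f l1) as [|y m IH]; simpl; [|rewrite IH]; ring. }
    rewrite Hsum.
    replace (list_sum f (l1 ++ l2) + f a - (s + f a))
      with (list_sum f (l1 ++ l2) - s) by ring.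
    assert (Hna : ~ In a (l1 ++ l2)) by now apply NoDup_remove_2.
    apply H0; [split|].
    + now apply NoDup_remove_1 in N.
    + intros x Hx; apply HB; split; [|intros ->; easy].
      apply HA; apply in_app_or in Hx; apply in_or_app; simpl; tauto.
    + intros x Hx.
      assert (Hx' := Hl x (or_intror Hx)).
      assert (x <> a) by now apply HB, B0.
      apply in_app_or in Hx'; apply in_or_app; simpl in Hx'.
      destruct Hx' as [?|[?|?]]; [tauto|congruence|tauto].
Qed.

(** * Complex functions with a continuous slope *)

Definition cont2 (P : C -> C -> C) (a b : C) : Prop :=
  forall eps : R, (0 < eps)%R -> exists d : R, (0 < d)%R /\
    forall u v, (Cmod (u - a) < d)%R -> (Cmod (v - b) < d)%R ->
      (Cmod (P u v - P a b) < eps)%R.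

Lemma cont2_const (c a b : C) : cont2 (fun _ _ => c) a b.
Proof.
  intros eps He; exists 1%R; split; [lra|]; intros u v _ _.
  replace (c - c) with (RtoC 0) by ring; now rewrite Cmod_0.
Qed.

Lemma cont2_fst (a b : C) : cont2 (fun u _ => u) a b.
Proof. intros eps He; exists eps; auto. Qed.

Lemma cont2_snd (a b : C) : cont2 (fun _ v => v) a b.
Proof. intros eps He; exists eps; auto. Qed.

Lemma cont2_ext (P Q : C -> C -> C) (a b : C) :
  (forall u v, P u v = Q u v) -> cont2 P a b -> cont2 Q a b.
Proof.
  intros H HP eps He; destruct (HP eps He) as [d [Hd H1]]; exists d; split; [easy|].
  intros u v Hu Hv; rewrite <- !H; auto.
Qed.

Lemma cont2_ext_near (P Q : C -> C -> C) (a b : C) (r : R) :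
  (0 < r)%R ->
  (forall u v, (Cmod (u - a) < r)%R -> (Cmod (v - b) < r)%R -> P u v = Q u v) ->
  cont2 P a b -> cont2 Q a b.
Proof.
  intros Hr H HP eps He; destruct (HP eps He) as [d [Hd H1]].
  exists (Rmin r d); split; [now apply Rmin_glb_lt|].
  intros u v Hu Hv.
  assert (Ha : (Cmod (a - a) < r)%R)
    by (replace (a - a) with (RtoC 0) by ring; now rewrite Cmod_0).
  assert (Hb : (Cmod (b - b) < r)%R)
    by (replace (b - b) with (RtoC 0) by ring; now rewrite Cmod_0).
  generalize (Rmin_l r d) (Rmin_r r d); intros Hl Hr'.
  rewrite <- (H u v), <- (H a b); try lra; try easy.
  apply H1; lra.
Qed.

Lemma cont2_plus (P Q : C -> C -> C) (a b : C) :
  cont2 P a b -> cont2 Q a b -> cont2 (fun u v => P u v + Q u v) a b.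
Proof.
  intros HP HQ eps He.
  destruct (HP (eps / 2)%R) as [d1 [Hd1 H1]]; [lra|].
  destruct (HQ (eps / 2)%R) as [d2 [Hd2 H2]]; [lra|].
  exists (Rmin d1 d2); split; [now apply Rmin_glb_lt|].
  intros u v Hu Hv; generalize (Rmin_l d1 d2) (Rmin_r d1 d2); intros Hl Hr.
  assert (K1 := H1 u v ltac:(lra) ltac:(lra)).
  assert (K2 := H2 u v ltac:(lra) ltac:(lra)).
  replace (P u v + Q u v - (P a b + Q a b))
    with (P u v - P a b + (Q u v - Q a b)) by ring.
  eapply Rle_lt_trans; [apply Cmod_triangle|]; lra.
Qed.

Lemma cont2_mult (P Q : C -> C -> C) (a b : C) :
  cont2 P a b -> cont2 Q a b -> cont2 (fun u v => P u v * Q u v) a b.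
Proof.
  intros HP HQ eps He.
  set (p := Cmod (P a b)); set (q := Cmod (Q a b)).
  assert (Hp : (0 <= p)%R) by apply Cmod_ge_0.
  assert (Hq : (0 <= q)%R) by apply Cmod_ge_0.
  (* The increment of the product splits into terms of size at most [e * e], [e * q] and [p * e]; as
     [e <= 1], their sum is at most [e * (p + q + 1)]. *)
  set (e := Rmin 1 (eps / (p + q + 1))%R).
  assert (He' : (0 < e)%R)
    by (apply Rmin_glb_lt; [lra|]; apply Rdiv_lt_0_compat; lra).
  assert (Hee : (e * (p + q + 1) <= eps)%R).
  { apply Rle_trans with (eps / (p + q + 1) * (p + q + 1))%R.
    - apply Rmult_le_compat_r; [lra|apply Rmin_r].
    - right; field; lra. }
  assert (He1 : (e <= 1)%R) by apply Rmin_l.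
  destruct (HP e He') as [d1 [Hd1 H1]].
  destruct (HQ e He') as [d2 [Hd2 H2]].
  exists (Rmin d1 d2); split; [now apply Rmin_glb_lt|].
  intros u v Hu Hv; generalize (Rmin_l d1 d2) (Rmin_r d1 d2); intros Hl Hr.
  assert (K1 := H1 u v ltac:(lra) ltac:(lra)).
  assert (K2 := H2 u v ltac:(lra) ltac:(lra)).
  replace (P u v * Q u v - P a b * Q a b)
    with ((P u v - P a b) * (Q u v - Q a b)
          + ((P u v - P a b) * Q a b + P a b * (Q u v - Q a b))) by ring.
  eapply Rle_lt_trans; [apply Cmod_triangle|].
  eapply Rle_lt_trans; [apply Rplus_le_compat_l, Cmod_triangle|].
  rewrite !Cmod_mult; fold p q.
  set (x := Cmod (P u v - P a b)) in *; set (y := Cmod (Q u v - Q a b)) in *.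
  assert (Hx : (0 <= x)%R) by apply Cmod_ge_0.
  assert (Hy : (0 <= y)%R) by apply Cmod_ge_0.
  assert (x * y < e)%R by nra.
  assert (x * q <= e * q)%R by nra.
  assert (p * y <= p * e)%R by nra.
  lra.
Qed.

Lemma cont2_opp (P : C -> C -> C) (a b : C) :
  cont2 P a b -> cont2 (fun u v => - P u v) a b.
Proof.
  intros H; apply (cont2_ext (fun u v => RtoC (-1) * P u v));
    [intros; ring|apply cont2_mult; [apply cont2_const|exact H]].
Qed.

Lemma cont2_inv (P : C -> C -> C) (a b : C) :
  P a b <> 0 -> cont2 P a b -> cont2 (fun u v => / P u v) a b.
Proof.
  intros H0 HP eps He.
  set (p := Cmod (P a b)).
  assert (Hp : (0 < p)%R) by now apply Cmod_gt_0.
  set (e := Rmin (p / 2) (eps * (p * p / 2))%R).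
  assert (Hpp : (0 < p * p)%R) by nra.
  assert (He' : (0 < e)%R) by (apply Rmin_glb_lt; [lra|nra]).
  destruct (HP e He') as [d [Hd H]].
  exists d; split; [exact Hd|]; intros u v Hu Hv.
  specialize (H u v Hu Hv).
  assert (Hl : (e <= p / 2)%R) by apply Rmin_l.
  assert (Hr : (e <= eps * (p * p / 2))%R) by apply Rmin_r.
  assert (Huv : (p / 2 < Cmod (P u v))%R).
  { assert (p <= Cmod (P u v) + Cmod (P u v - P a b))%R.
    { unfold p; rewrite <- (Cmod_opp (P u v - P a b)).
      replace (P a b) with (P u v + - (P u v - P a b)) at 1 by ring.
      apply Cmod_triangle. }
    lra. }
  assert (Hne : P u v <> 0) by (apply Cmod_gt_0; lra).
  replace (/ P u v - / P a b) with (- (P u v - P a b) * / (P u v * P a b))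
    by (field; auto).
  rewrite Cmod_mult, Cmod_opp, Cmod_inv, Cmod_mult by now apply Cmult_neq_0.
  fold p.
  assert (Hden : (p * p / 2 < Cmod (P u v) * p)%R) by nra.
  apply Rmult_lt_reg_r with (Cmod (P u v) * p)%R; [lra|].
  rewrite Rmult_assoc, Rinv_l by lra. nra.
Qed.

Lemma cont2_affine (P : C -> C -> C) (k c a b : C) :
  cont2 P (k * a + c) (k * b + c) ->
  cont2 (fun u v => P (k * u + c) (k * v + c)) a b.
Proof.
  intros H eps He; destruct (H eps He) as [d [Hd H1]].
  (* The [+ 1] keeps the divisor positive when [k = 0]. *)
  assert (Hk : (0 < Cmod k + 1)%R) by (generalize (Cmod_ge_0 k); lra).
  exists (d / (Cmod k + 1))%R; split; [now apply Rdiv_lt_0_compat|].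
  assert (Haux : forall u x, (Cmod (u - x) < d / (Cmod k + 1))%R ->
            (Cmod (k * u + c - (k * x + c)) < d)%R).
  { intros u x Hu.
    replace (k * u + c - (k * x + c)) with (k * (u - x)) by ring.
    rewrite Cmod_mult.
    apply (Rmult_lt_compat_l _ _ _ Hk) in Hu.
    replace ((Cmod k + 1) * (d / (Cmod k + 1)))%R with d in Hu by (field; lra).
    generalize (Cmod_ge_0 (u - x)); lra. }
  intros u v Hu Hv; apply H1; auto.
Qed.

(* Hadamard's form of continuous differentiability near [z], with derivative [d]
   at [z]. Unlike a limit of quotients it is stable under the algebraic
   operations by mere ring identities. *)
Definition C1 (f : C -> C) (z d : C) : Prop :=
  exists (Phi : C -> C -> C) (r : R), (0 < r)%R /\ Phi z z = d /\
    forall u v, (Cmod (u - z) < r)%R -> (Cmod (v - z) < r)%R ->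
      f u - f v = (u - v) * Phi u v /\ cont2 Phi u v.

Lemma Cmod_self (z : C) (r : R) : (0 < r)%R -> (Cmod (z - z) < r)%R.
Proof. intros Hr; replace (z - z) with (RtoC 0) by ring; now rewrite Cmod_0. Qed.

Lemma Cmod_near (z u : C) (r : R) :
  (Cmod (u - z) < r)%R ->
  exists s, (0 < s)%R /\ forall v, (Cmod (v - u) < s)%R -> (Cmod (v - z) < r)%R.
Proof.
  intros H; exists (r - Cmod (u - z))%R; split; [lra|]; intros v Hv.
  replace (v - z) with (v - u + (u - z)) by ring.
  eapply Rle_lt_trans; [apply Cmod_triangle|]; lra.
Qed.

Lemma C1_const (c z : C) : C1 (fun _ => c) z 0.
Proof.
  exists (fun _ _ => RtoC 0), 1%R; split; [lra|]; split; [easy|].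
  intros u v _ _; split; [ring|apply cont2_const].
Qed.

Lemma C1_id (z : C) : C1 (fun u => u) z 1.
Proof.
  exists (fun _ _ => RtoC 1), 1%R; split; [lra|]; split; [easy|].
  intros u v _ _; split; [ring|apply cont2_const].
Qed.

Lemma C1_eq (f : C -> C) (z d e : C) : d = e -> C1 f z d -> C1 f z e.
Proof. now intros ->. Qed.

Lemma C1_ext (f g : C -> C) (z d : C) (r : R) :
  (0 < r)%R -> (forall u, (Cmod (u - z) < r)%R -> f u = g u) ->
  C1 f z d -> C1 g z d.
Proof.
  intros Hr Hfg [Phi [s [Hs [Hd H]]]].
  exists Phi, (Rmin r s); split; [now apply Rmin_glb_lt|]; split; [exact Hd|].
  intros u v Hu Hv; generalize (Rmin_l r s) (Rmin_r r s); intros Hl Hr'.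
  rewrite <- !Hfg by lra; apply H; lra.
Qed.

Lemma C1_plus (f g : C -> C) (z d e : C) :
  C1 f z d -> C1 g z e -> C1 (fun u => f u + g u) z (d + e).
Proof.
  intros [P [r [Hr [HP Hf]]]] [Q [s [Hs [HQ Hg]]]].
  exists (fun u v => P u v + Q u v), (Rmin r s).
  split; [now apply Rmin_glb_lt|]; split; [now rewrite HP, HQ|].
  intros u v Hu Hv; generalize (Rmin_l r s) (Rmin_r r s); intros Hl Hr'.
  destruct (Hf u v) as [E1 K1]; [lra|lra|].
  destruct (Hg u v) as [E2 K2]; [lra|lra|].
  split; [|now apply cont2_plus].
  replace (f u + g u - (f v + g v)) with (f u - f v + (g u - g v)) by ring.
  rewrite E1, E2; ring.
Qed.

(** On the disc [f x = f u + (x - u) * P x u], so continuity of the slope passes to [f]. It is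
    wanted in either slot because the slope of a product contains the values of both factors. *)
Lemma cont2_C1_fst (f : C -> C) (P : C -> C -> C) (z : C) (r : R) (u v : C) :
  (forall u v, (Cmod (u - z) < r)%R -> (Cmod (v - z) < r)%R ->
      f u - f v = (u - v) * P u v /\ cont2 P u v) ->
  (Cmod (u - z) < r)%R -> cont2 (fun x _ => f x) u v /\ cont2 (fun _ x => f x) v u.
Proof.
  intros Hf Hu.
  assert (H : cont2 (fun x y => f u + (x - u) * P x u) u u).
  { apply cont2_plus; [apply cont2_const|]; apply cont2_mult.
    - apply cont2_plus; [apply cont2_fst|apply cont2_const].
    - intros eps He; destruct (proj2 (Hf u u Hu Hu) eps He) as [d [Hd H]].
      exists d; split; [exact Hd|]; intros x y Hx _; apply H; [exact Hx|].
      now apply Cmod_self. }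
  destruct (Cmod_near z u r Hu) as [s [Hs Hnear]].
  assert (Hc : cont2 (fun x _ => f x) u u).
  { apply (cont2_ext_near (fun x _ => f u + (x - u) * P x u) _ u u s Hs);
      [|exact H].
    intros x y Hx _; cbv beta.
    rewrite <- (proj1 (Hf x u (Hnear x Hx) Hu)); ring. }
  split; intros eps He; destruct (Hc eps He) as [d [Hd H1]];
    exists d; split; try exact Hd; intros x y Hx Hy; [apply (H1 x u)|apply (H1 y u)];
    try easy; now apply Cmod_self.
Qed.

Lemma C1_mult (f g : C -> C) (z d e : C) :
  C1 f z d -> C1 g z e -> C1 (fun u => f u * g u) z (d * g z + f z * e).
Proof.
  intros [P [r [Hr [HP Hf]]]] [Q [s [Hs [HQ Hg]]]].
  exists (fun u v => P u v * g v + f u * Q u v), (Rmin r s).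
  split; [now apply Rmin_glb_lt|]; split; [now rewrite HP, HQ|].
  intros u v Hu Hv; generalize (Rmin_l r s) (Rmin_r r s); intros Hl Hr'.
  destruct (Hf u v) as [E1 K1]; [lra|lra|].
  destruct (Hg u v) as [E2 K2]; [lra|lra|].
  split.
  - replace (f u * g u - f v * g v)
      with ((f u - f v) * g v + f u * (g u - g v)) by ring.
    rewrite E1, E2; ring.
  - apply cont2_plus; apply cont2_mult; try assumption.
    + apply (cont2_C1_fst g Q z s v u Hg); lra.
    + apply (cont2_C1_fst f P z r u v Hf); lra.
Qed.

Lemma C1_scal (c : C) (f : C -> C) (z d : C) :
  C1 f z d -> C1 (fun u => c * f u) z (c * d).
Proof.
  intros H; eapply C1_eq; [|exact (C1_mult _ _ z _ _ (C1_const c z) H)]; cbv beta; ring.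
Qed.

Lemma C1_opp (f : C -> C) (z d : C) : C1 f z d -> C1 (fun u => - f u) z (- d).
Proof.
  intros H; apply (C1_ext (fun u => RtoC (-1) * f u) _ z _ 1 Rlt_0_1);
    [intros; ring|].
  eapply C1_eq; [|exact (C1_scal (RtoC (-1)) f z d H)]; ring.
Qed.

Lemma C1_minus (f g : C -> C) (z d e : C) :
  C1 f z d -> C1 g z e -> C1 (fun u => f u - g u) z (d - e).
Proof. intros Hf Hg; exact (C1_plus _ _ _ _ _ Hf (C1_opp _ _ _ Hg)). Qed.

Lemma C1_affine (f : C -> C) (k c z d : C) :
  C1 f (k * z + c) d -> C1 (fun u => f (k * u + c)) z (k * d).
Proof.
  intros [P [r [Hr [HP Hf]]]].
  assert (Hk : (0 < Cmod k + 1)%R) by (generalize (Cmod_ge_0 k); lra).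
  exists (fun u v => k * P (k * u + c) (k * v + c)), (r / (Cmod k + 1))%R.
  split; [now apply Rdiv_lt_0_compat|]; split; [now rewrite HP|].
  assert (Haux : forall u, (Cmod (u - z) < r / (Cmod k + 1))%R ->
            (Cmod (k * u + c - (k * z + c)) < r)%R).
  { intros u Hu.
    replace (k * u + c - (k * z + c)) with (k * (u - z)) by ring.
    rewrite Cmod_mult.
    apply (Rmult_lt_compat_l _ _ _ Hk) in Hu.
    replace ((Cmod k + 1) * (r / (Cmod k + 1)))%R with r in Hu by (field; lra).
    generalize (Cmod_ge_0 (u - z)); lra. }
  intros u v Hu Hv; destruct (Hf _ _ (Haux u Hu) (Haux v Hv)) as [E K]; split.
  - rewrite E; ring.
  - apply cont2_mult; [apply cont2_const|now apply cont2_affine].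
Qed.

Lemma C1_shift (f : C -> C) (z c d : C) : C1 f (z + c) d -> C1 (fun u => f (u + c)) z d.
Proof.
  intros H; apply (C1_ext (fun u => f (1 * u + c)) _ z d 1 Rlt_0_1).
  - intros u _; now rewrite Cmult_1_l.
  - replace d with (1 * d) by ring; apply C1_affine; now rewrite Cmult_1_l.
Qed.

Lemma C1_inv_id (z : C) : z <> 0 -> C1 (fun u => / u) z (- / (z * z)).
Proof.
  intros Hz; assert (Hm : (0 < Cmod z)%R) by now apply Cmod_gt_0.
  assert (Haux : forall u, (Cmod (u - z) < Cmod z)%R -> u <> 0).
  { intros u Hu ->; replace (0 - z) with (- z) in Hu by ring.
    rewrite Cmod_opp in Hu; lra. }
  exists (fun u v => - / (u * v)), (Cmod z); split; [exact Hm|]; split; [easy|].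
  intros u v Hu Hv; specialize (Haux u Hu) as Hu0; specialize (Haux v Hv) as Hv0.
  split; [field; auto|].
  apply cont2_opp, cont2_inv; [now apply Cmult_neq_0|].
  apply cont2_mult; [apply cont2_fst|apply cont2_snd].
Qed.

Lemma C1_continuous (f : C -> C) (z d : C) (eps : R) :
  C1 f z d -> (0 < eps)%R ->
  exists s, (0 < s)%R /\ forall u, (Cmod (u - z) < s)%R -> (Cmod (f u - f z) < eps)%R.
Proof.
  intros [P [r [Hr [_ Hf]]]] He.
  destruct (cont2_C1_fst f P z r z z Hf (Cmod_self z r Hr)) as [Hc _].
  destruct (Hc eps He) as [s [Hs H]]; exists s; split; [exact Hs|].
  intros u Hu; apply (H u z Hu); now apply Cmod_self.
Qed.

Lemma C1_is_derive (f : C -> C) (z d : C) : C1 f z d -> is_derive f z d.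
Proof.
  intros [P [r [Hr [Hd Hf]]]].
  split; [apply is_linear_scal_l|].
  intros x Hx.
  apply (is_filter_lim_locally_unique (V := AbsRing_NormedModule C_AbsRing)) in Hx.
  subst x.
  intros eps.
  destruct (proj2 (Hf z z (Cmod_self z r Hr) (Cmod_self z r Hr)) eps (cond_pos eps))
    as [s [Hs H]].
  exists (mkposreal _ (Rmin_glb_lt _ _ _ Hr Hs)); intros y Hy.
  assert (Hy' : (Cmod (y - z) < Rmin r s)%R) by exact Hy.
  generalize (Rmin_l r s) (Rmin_r r s); intros Hl Hr'.
  assert (Hyr : (Cmod (y - z) < r)%R) by lra.
  change (Cmod (f y - f z - (y - z) * d) <= eps * Cmod (y - z))%R.
  rewrite (proj1 (Hf y z Hyr (Cmod_self z r Hr))), <- Hd.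
  replace ((y - z) * P y z - (y - z) * P z z)
    with ((y - z) * (P y z - P z z)) by ring.
  rewrite Cmod_mult, Rmult_comm.
  apply Rmult_le_compat_r; [apply Cmod_ge_0|].
  left; apply H; [lra|now apply Cmod_self].
Qed.

Lemma C1_C_derive (f : C -> C) (z d : C) : C1 f z d -> C_derive f z = d.
Proof. intros H; now apply is_C_derive_unique, C1_is_derive. Qed.

Lemma C1_unique (f : C -> C) (z d e : C) : C1 f z d -> C1 f z e -> d = e.
Proof. intros Hd He; now rewrite <- (C1_C_derive f z d Hd), (C1_C_derive f z e He). Qed.

(** Near [z] the derivative is the diagonal [P u u] of the slope, so it inherits the joint
    continuity of [P]. Differentiation under the integral sign relies on this. *)
Lemma C1_derive_continuous (f : C -> C) (z d : C) (eps : R) :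
  C1 f z d -> (0 < eps)%R ->
  exists s, (0 < s)%R /\ forall u, (Cmod (u - z) < s)%R ->
    (Cmod (C_derive f u - C_derive f z) < eps)%R.
Proof.
  intros Hf0 He; rewrite (C1_C_derive f z d Hf0).
  destruct Hf0 as [P [r [Hr [Hd Hf]]]].
  destruct (proj2 (Hf z z (Cmod_self z r Hr) (Cmod_self z r Hr)) eps He)
    as [s [Hs H]].
  exists (Rmin r s); split; [now apply Rmin_glb_lt|]; intros u Hu.
  generalize (Rmin_l r s) (Rmin_r r s); intros Hl Hr'.
  assert (Hur : (Cmod (u - z) < r)%R) by lra.
  replace (C_derive f u) with (P u u).
  - rewrite <- Hd; apply H; lra.
  - symmetry; apply C1_C_derive.
    destruct (Cmod_near z u r Hur) as [t [Ht Hnear]].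
    exists P, t; split; [exact Ht|]; split; [easy|].
    intros x y Hx Hy; apply Hf; auto.
Qed.

(** * Liouville's theorem *)

Lemma Cmod_le_abs (a b : R) : (Cmod (a, b) <= Rabs a + Rabs b)%R.
Proof.
  replace ((a, b) : C) with (RtoC a + Ci * RtoC b)
    by (unfold Cplus, Cmult, RtoC, Ci; simpl; f_equal; ring).
  eapply Rle_trans; [apply Cmod_triangle|].
  rewrite Cmod_mult, Cmod_Ci, !Cmod_R; lra.
Qed.

(** The factor [x s - x t] vanishes at [t], so mere continuity of [A] suffices. With [A] a component
    of the slope of [f] along a path, this becomes the chain rule. *)
Lemma is_derive_slope_mult (x A : R -> R) (t x' : R) :
  is_derive x t x' -> continuity_pt A t ->
  is_derive (fun s => (x s - x t) * A s)%R t (x' * A t)%R.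
Proof.
  intros Hx HA; apply is_derive_Reals in Hx; apply is_derive_Reals.
  intros eps He.
  (* [continuity_pt] speaks only of points different from [t]; the case [h = 0] is added here. *)
  assert (HA' : forall e, (0 < e)%R -> exists d, (0 < d)%R /\
            forall h, (Rabs h < d)%R -> (Rabs (A (t + h)%R - A t) < e)%R).
  { intros e Hpos; destruct (HA e Hpos) as [d [Hd H]]; exists d; split; [exact Hd|].
    intros h Hh; destruct (Req_dec h 0) as [->|Hh0].
    - rewrite Rplus_0_r, Rminus_diag, Rabs_R0; exact Hpos.
    - apply H; split; [split; [exact I|lra]|].
      simpl; unfold Rdist; now replace (t + h - t)%R with h by ring. }
  assert (HM : (0 < Rabs (A t) + Rabs x' + 1)%R)
    by (generalize (Rabs_pos (A t)) (Rabs_pos x'); lra).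
  set (M := (Rabs (A t) + Rabs x' + 1)%R) in HM.
  set (e := Rmin 1 (eps / (2 * M))%R).
  assert (Hepos : (0 < e)%R)
    by (apply Rmin_glb_lt; [lra|]; apply Rdiv_lt_0_compat; lra).
  assert (He1 : (e <= 1)%R) by apply Rmin_l.
  assert (HeM : (e * M <= eps / 2)%R).
  { apply Rle_trans with (eps / (2 * M) * M)%R.
    - apply Rmult_le_compat_r; [lra|apply Rmin_r].
    - right; field; lra. }
  destruct (Hx e Hepos) as [d1 H1].
  destruct (HA' e Hepos) as [d2 [Hd2 H2]].
  exists (mkposreal _ (Rmin_glb_lt _ _ _ (cond_pos d1) Hd2)); simpl.
  intros h Hh0 Hh; generalize (Rmin_l d1 d2) (Rmin_r d1 d2); intros Hl Hr.
  assert (K1 := H1 h Hh0 ltac:(lra)).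
  assert (K2 := H2 h ltac:(lra)).
  set (q := ((x (t + h)%R - x t) / h)%R) in *.
  replace (((x (t + h)%R - x t) * A (t + h)%R - (x t - x t) * A t) / h - x' * A t)%R
    with ((q - x') * (A (t + h)%R - A t) + ((q - x') * A t + x' * (A (t + h)%R - A t)))%R
    by (unfold q; field; exact Hh0).
  eapply Rle_lt_trans; [apply Rabs_triang|].
  eapply Rle_lt_trans; [apply Rplus_le_compat_l, Rabs_triang|].
  rewrite !Rabs_mult.
  generalize (Rabs_pos (q - x')) (Rabs_pos (A (t + h)%R - A t))
    (Rabs_pos (A t)) (Rabs_pos x'); intros.
  assert (Rabs (q - x') * Rabs (A (t + h)%R - A t) <= e * 1)%R
    by (apply Rmult_le_compat; lra).
  assert (Rabs (q - x') * Rabs (A t) <= e * Rabs (A t))%R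
    by (apply Rmult_le_compat_r; lra).
  assert (Rabs x' * Rabs (A (t + h)%R - A t) <= Rabs x' * e)%R
    by (apply Rmult_le_compat_l; lra).
  unfold M in HeM; lra.
Qed.

Lemma is_derive_continuity_pt (x : R -> R) (t x' : R) :
  is_derive x t x' -> continuity_pt x t.
Proof.
  intros H; apply continuity_pt_filterlim.
  apply (ex_derive_continuous x t); now exists x'.
Qed.

(** Along the path, [f - f z] is the increment of the path times the slope with second argument [z].
    Its real part consists of two products of the shape treated in [is_derive_slope_mult]. *)
Lemma is_derive_Re_comp (f : C -> C) (x y : R -> R) (t x' y' : R) (d : C) :
  C1 f (x t, y t) d -> is_derive x t x' -> is_derive y t y' ->
  is_derive (fun s => Re (f (x s, y s))) t (Re (d * (x', y'))).
Proof.
  intros [P [r [Hr [Hd Hf]]]] Hx Hy.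
  set (z := (x t, y t) : C) in *.
  assert (Hpath : forall e, (0 < e)%R -> exists s, (0 < s)%R /\
            forall u, (Rabs (u - t) < s)%R -> (Cmod ((x u, y u) - z) < e)%R).
  { intros e He.
    destruct (is_derive_continuity_pt _ _ _ Hx (e / 2)%R) as [s1 [Hs1 H1]]; [lra|].
    destruct (is_derive_continuity_pt _ _ _ Hy (e / 2)%R) as [s2 [Hs2 H2]]; [lra|].
    exists (Rmin s1 s2); split; [now apply Rmin_glb_lt|].
    intros u Hu; generalize (Rmin_l s1 s2) (Rmin_r s1 s2); intros Hl Hr'.
    destruct (Req_dec u t) as [->|Hut]; [now apply Cmod_self|].
    assert (K1 := H1 u). assert (K2 := H2 u).
    simpl in K1, K2; unfold Rdist in K1, K2.
    assert (E : ((x u, y u) : C) - z = ((x u - x t)%R, (y u - y t)%R)) by reflexivity.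
    rewrite E.
    eapply Rle_lt_trans; [apply Cmod_le_abs|].
    assert (Rabs (x u - x t) < e / 2)%R.
    { apply K1; split; [split; [exact I|congruence]|lra]. }
    assert (Rabs (y u - y t) < e / 2)%R.
    { apply K2; split; [split; [exact I|congruence]|lra]. }
    lra. }
  assert (HP : forall p : C -> R,
            (forall c c' : C, (Rabs (p c - p c') <= Cmod (c - c'))%R) ->
            continuity_pt (fun s => p (P (x s, y s) z)) t).
  { intros p Hp eps He.
    destruct (proj2 (Hf z z (Cmod_self z r Hr) (Cmod_self z r Hr)) eps He)
      as [s [Hs H]].
    destruct (Hpath s Hs) as [s' [Hs' H']].
    exists s'; split; [exact Hs'|]; intros u [_ Hu].
    simpl in Hu |- *; unfold Rdist in *.
    eapply Rle_lt_trans; [apply Hp|].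
    apply H; [now apply H'|now apply Cmod_self]. }
  assert (HRe : forall c c' : C, (Rabs (Re c - Re c') <= Cmod (c - c'))%R)
    by (intros c c'; exact (re_le_Cmod (c - c'))).
  assert (HIm : forall c c' : C, (Rabs (Im c - Im c') <= Cmod (c - c'))%R).
  { intros c c'; eapply Rle_trans; [|apply Rmax_Cmod].
    exact (Rmax_r (Rabs (fst (c - c'))) (Rabs (snd (c - c')))). }
  assert (HD := is_derive_minus _ _ _ _ _
    (is_derive_slope_mult x _ t x' Hx (HP Re HRe))
    (is_derive_slope_mult y _ t y' Hy (HP Im HIm))).
  destruct (Hpath r Hr) as [s [Hs Hnear]].
  assert (Heq : is_derive
    (fun u => Re (f z) + ((x u - x t) * Re (P (x u, y u) z)
                          - (y u - y t) * Im (P (x u, y u) z)))%R t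
    (Re (d * (x', y')))).
  { replace (Re (d * (x', y')))
      with (0 + (x' * Re (P z z) - y' * Im (P z z)))%R
      by (rewrite Hd; unfold Re, Im, Cmult; simpl; ring).
    apply (is_derive_plus (fun _ => Re (f z)));
      [apply (is_derive_const (V := R_NormedModule))|exact HD]. }
  eapply is_derive_ext_loc; [|exact Heq].
  exists (mkposreal s Hs); intros u Hu.
  assert (Hu' : (Cmod ((x u, y u) - z) < r)%R) by (apply Hnear; exact Hu).
  assert (E := proj1 (Hf _ _ Hu' (Cmod_self z r Hr))).
  replace (f (x u, y u)) with (f z + (f (x u, y u) - f z)) by ring.
  rewrite E; unfold Re, Im, Cmult, Cplus, Cminus, Copp; simpl; ring.
Qed.

Lemma is_derive_Im_comp (f : C -> C) (x y : R -> R) (t x' y' : R) (d : C) :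
  C1 f (x t, y t) d -> is_derive x t x' -> is_derive y t y' ->
  is_derive (fun s => Im (f (x s, y s))) t (Im (d * (x', y'))).
Proof.
  intros Hf Hx Hy.
  assert (H := is_derive_Re_comp _ x y t x' y' _ (C1_scal (- Ci) f _ d Hf) Hx Hy).
  replace (Im (d * (x', y'))) with (Re (- Ci * d * (x', y')))
    by (unfold Re, Im, Cmult, Copp, Ci; simpl; ring).
  eapply is_derive_ext; [|exact H].
  intros s; unfold Re, Im, Cmult, Copp, Ci; simpl; ring.
Qed.

(** * Circular means of a bounded complex differentiable function *)

Section Circle.

Variables (f : C -> C) (z0 : C) (M : R).
Hypothesis Hf : forall z, exists d, C1 f z d.
Hypothesis HM : forall z, (Cmod (f z) <= M)%R.

Let g (r t : R) : C := (Re z0 + r * cos t, Im z0 + r * sin t)%R.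
(** [h] and [k] are the real part and minus the imaginary part of exp(-it) f. The Cauchy-Riemann
    equations in polar form then read ∂h/∂r = [p] and ∂k/∂t = [h - r * p], and [k] has period 2π in
    the angle. *)
Let h (r t : R) : R := (Re (f (g r t)) * cos t + Im (f (g r t)) * sin t)%R.
Let k (r t : R) : R := (Re (f (g r t)) * sin t - Im (f (g r t)) * cos t)%R.
Let p (r t : R) : R := Re (C_derive f (g r t)).

Let C1f (z : C) : C1 f z (C_derive f z).
Proof. destruct (Hf z) as [d Hd]; now rewrite (C1_C_derive f z d Hd). Qed.

Let h_derive_r (r t : R) : is_derive (fun s => h s t) r (p r t).
Proof.
  assert (Hx : is_derive (fun s => Re z0 + s * cos t)%R r (cos t))
    by (auto_derive; [easy|ring]).
  assert (Hy : is_derive (fun s => Im z0 + s * sin t)%R r (sin t))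
    by (auto_derive; [easy|ring]).
  assert (HRe := is_derive_Re_comp f _ _ r _ _ _ (C1f (g r t)) Hx Hy).
  assert (HIm := is_derive_Im_comp f _ _ r _ _ _ (C1f (g r t)) Hx Hy).
  assert (H := is_derive_plus _ _ _ _ _
    (is_derive_scal_l _ _ _ (cos t) HRe) (is_derive_scal_l _ _ _ (sin t) HIm)).
  replace (p r t) with (plus (scal (Re (C_derive f (g r t) * (cos t, sin t))) (cos t))
    (scal (Im (C_derive f (g r t) * (cos t, sin t))) (sin t))); [exact H|].
  unfold p; destruct (C_derive f (g r t)) as [a b].
  unfold plus, scal; simpl; unfold mult, Re, Im; simpl.
  transitivity (a * (Rsqr (sin t) + Rsqr (cos t)))%R; [unfold Rsqr; ring|].
  rewrite sin2_cos2; ring.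
Qed.

Let k_derive_t (r t : R) : is_derive (k r) t (h r t - r * p r t)%R.
Proof.
  assert (Hx : is_derive (fun s => Re z0 + r * cos s)%R t (- r * sin t)%R)
    by (auto_derive; [easy|ring]).
  assert (Hy : is_derive (fun s => Im z0 + r * sin s)%R t (r * cos t)%R)
    by (auto_derive; [easy|ring]).
  assert (HRe := is_derive_Re_comp f _ _ t _ _ _ (C1f (g r t)) Hx Hy).
  assert (HIm := is_derive_Im_comp f _ _ t _ _ _ (C1f (g r t)) Hx Hy).
  assert (H := is_derive_minus _ _ _ _ _
    (is_derive_mult _ _ _ _ _ HRe (is_derive_sin t) Rmult_comm)
    (is_derive_mult _ _ _ _ _ HIm (is_derive_cos t) Rmult_comm)).
  eapply is_derive_ext; [|match type of H with is_derive _ _ ?l =>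
    replace (h r t - r * p r t)%R with l; [exact H|] end].
  { intros s; reflexivity. }
  unfold h, p; destruct (C_derive f (g r t)) as [a b].
  unfold minus, plus, opp, mult, Re, Im; simpl.
  change (fst z0 + r * cos t, snd z0 + r * sin t)%R with (g r t).
  transitivity (fst (f (g r t)) * cos t + snd (f (g r t)) * sin t
    - r * (a * (Rsqr (sin t) + Rsqr (cos t))))%R; [unfold Rsqr; ring|].
  rewrite sin2_cos2; ring.
Qed.

Let circle_continuity (F : C -> C) (r t : R) :
  (forall z eps, (0 < eps)%R -> exists s, (0 < s)%R /\
     forall u, (Cmod (u - z) < s)%R -> (Cmod (F u - F z) < eps)%R) ->
  continuity_2d_pt (fun u v => Re (F (g u v))) r t.
Proof.
  intros HF eps.
  destruct (HF (g r t) eps (cond_pos eps)) as [s [Hs H]].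
  assert (Hs2 : (0 < s / 2)%R) by lra.
  assert (Hx : continuity_2d_pt (fun u v => Re z0 + u * cos v)%R r t).
  { apply continuity_2d_pt_plus; [apply continuity_2d_pt_const|].
    apply continuity_2d_pt_mult; [apply continuity_2d_pt_id1|].
    apply continuity_1d_2d_pt_comp; [apply continuity_cos|apply continuity_2d_pt_id2]. }
  assert (Hy : continuity_2d_pt (fun u v => Im z0 + u * sin v)%R r t).
  { apply continuity_2d_pt_plus; [apply continuity_2d_pt_const|].
    apply continuity_2d_pt_mult; [apply continuity_2d_pt_id1|].
    apply continuity_1d_2d_pt_comp; [apply continuity_sin|apply continuity_2d_pt_id2]. }
  destruct (Hx (mkposreal _ Hs2)) as [d1 H1].
  destruct (Hy (mkposreal _ Hs2)) as [d2 H2].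
  exists (mkposreal _ (Rmin_glb_lt _ _ _ (cond_pos d1) (cond_pos d2))); simpl.
  intros u v Hu Hv; generalize (Rmin_l d1 d2) (Rmin_r d1 d2); intros Hl Hr.
  assert (K1 := H1 u v ltac:(lra) ltac:(lra)).
  assert (K2 := H2 u v ltac:(lra) ltac:(lra)). simpl in K1, K2.
  eapply Rle_lt_trans; [exact (re_le_Cmod (F (g u v) - F (g r t)))|].
  apply H.
  eapply Rle_lt_trans; [apply Cmod_le_abs|].
  eapply Rlt_le_trans; [apply Rplus_lt_compat; [exact K1|exact K2]|lra].
Qed.

Let slice_continuous (q : R -> R -> R) (r t : R) :
  continuity_2d_pt q r t -> continuous (q r) t.
Proof.
  intros H P [eps HP].
  destruct (H eps) as [d Hd]; exists d; intros v Hv.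
  apply HP, Hd; [rewrite Rminus_diag, Rabs_R0; apply cond_pos|exact Hv].
Qed.

Let p_continuity (r t : R) : continuity_2d_pt p r t.
Proof.
  apply circle_continuity; intros z eps He.
  exact (C1_derive_continuous f z _ eps (C1f z) He).
Qed.

Let h_continuity (r t : R) : continuity_2d_pt h r t.
Proof.
  unfold h; apply continuity_2d_pt_plus; apply continuity_2d_pt_mult.
  - apply circle_continuity; intros z eps He.
    exact (C1_continuous f z _ eps (C1f z) He).
  - apply continuity_1d_2d_pt_comp; [apply continuity_cos|apply continuity_2d_pt_id2].
  - apply (continuity_2d_pt_ext (fun u v => Re ((fun x => - Ci * f x) (g u v)))).
    { intros u v; unfold Re, Im, Cmult, Copp, Ci; simpl; ring. }
    apply (circle_continuity (fun x => - Ci * f x)); intros z eps He.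
    exact (C1_continuous _ z _ eps (C1_scal (- Ci) f z _ (C1f z)) He).
  - apply continuity_1d_2d_pt_comp; [apply continuity_sin|apply continuity_2d_pt_id2].
Qed.

Let A (r : R) : R := RInt (h r) 0 (2 * PI).
Let B (r : R) : R := RInt (p r) 0 (2 * PI).

Let ex_h (r : R) : ex_RInt (h r) 0 (2 * PI).
Proof. apply (ex_RInt_continuous (V := R_CompleteNormedModule)); intros; apply slice_continuous, h_continuity. Qed.

Let ex_p (r : R) : ex_RInt (p r) 0 (2 * PI).
Proof. apply (ex_RInt_continuous (V := R_CompleteNormedModule)); intros; apply slice_continuous, p_continuity. Qed.

Let A_derive (r : R) : is_derive A r (B r).
Proof.
  replace (B r) with (RInt (fun t => Derive (fun u => h u t) r) 0 (2 * PI)).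
  - apply (is_derive_RInt_param h).
    + exists (mkposreal 1 Rlt_0_1); intros s _ t _; eexists; apply h_derive_r.
    + intros t _; apply (continuity_2d_pt_ext p); [|apply p_continuity].
      intros u v; symmetry; apply is_derive_unique, h_derive_r.
    + exists (mkposreal 1 Rlt_0_1); intros s _; apply ex_h.
  - apply RInt_ext; intros t _; apply is_derive_unique, h_derive_r.
Qed.

(* Integration by parts in the angle. *)
Let A_eq (r : R) : A r = (r * B r)%R.
Proof.
  assert (H : is_RInt (fun t => h r t - r * p r t)%R 0 (2 * PI)
                (minus (k r (2 * PI)) (k r 0))).
  { apply (is_RInt_derive (V := R_CompleteNormedModule)).
    - intros t _; apply k_derive_t.
    - intros t _; apply slice_continuous with (q := fun r t => (h r t - r * p r t)%R).
      apply continuity_2d_pt_minus; [apply h_continuity|].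
      apply continuity_2d_pt_mult; [apply continuity_2d_pt_id1|apply p_continuity]. }
  assert (H' : is_RInt (fun t => h r t - r * p r t)%R 0 (2 * PI) (A r - r * B r)%R).
  { apply (is_RInt_minus (V := R_NormedModule)).
    - apply (RInt_correct (V := R_CompleteNormedModule)), ex_h.
    - apply (is_RInt_scal (V := R_NormedModule)).
      apply (RInt_correct (V := R_CompleteNormedModule)), ex_p. }
  assert (E := eq_trans (eq_sym (is_RInt_unique _ _ _ _ H)) (is_RInt_unique _ _ _ _ H')).
  unfold minus, plus, opp in E; simpl in E.
  unfold k, g in E; rewrite cos_2PI, sin_2PI, cos_0, sin_0 in E; lra.
Qed.

Let A_bound (r : R) : (Rabs (A r) <= 4 * PI * M)%R.
Proof.
  replace (4 * PI * M)%R with ((2 * PI - 0) * (2 * M))%R by ring.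
  apply abs_RInt_le_const; [generalize PI_RGT_0; lra|apply ex_h|].
  intros t _; unfold h.
  eapply Rle_trans; [apply Rabs_triang|]; rewrite !Rabs_mult.
  assert (H1 : (Rabs (Re (f (g r t))) <= M)%R)
    by (eapply Rle_trans; [apply re_le_Cmod|apply HM]).
  assert (H2 : (Rabs (Im (f (g r t))) <= M)%R).
  { eapply Rle_trans; [|apply HM]; eapply Rle_trans; [|apply Rmax_Cmod]; apply Rmax_r. }
  assert (H3 : (Rabs (cos t) <= 1)%R) by (apply Rabs_le, COS_bound).
  assert (H4 : (Rabs (sin t) <= 1)%R) by (apply Rabs_le, SIN_bound).
  generalize (Rabs_pos (Re (f (g r t)))) (Rabs_pos (Im (f (g r t))))
    (Rabs_pos (cos t)) (Rabs_pos (sin t)); intros.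
  nra.
Qed.

(** From A' = B and A = r B, the quotient A(r)/r has derivative zero for r > 0, hence is constant;
    as A is bounded, letting r grow makes this constant zero. *)
Let A_zero (r : R) : (0 < r)%R -> A r = 0%R.
Proof.
  intros Hr.
  assert (Hconst : forall s, (r < s)%R -> (A r / r = A s / s)%R).
  { intros s Hs.
    apply (eq_is_derive (fun x => A x / x)%R r s); [|exact Hs].
    intros x Hx.
    replace (zero : R_NormedModule) with ((B x * x - A x * 1) / x ^ 2)%R
      by (rewrite A_eq; unfold zero; simpl; field; lra).
    apply is_derive_div; [apply A_derive|apply (is_derive_id (K := R_AbsRing))|lra]. }
  apply NNPP; intros Hne.
  assert (Hpos : (0 < Rabs (A r))%R) by now apply Rabs_pos_lt.
  assert (HM0 : (0 <= M)%R) by (eapply Rle_trans; [apply Cmod_ge_0|apply (HM z0)]).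
  assert (HK : (0 <= 4 * PI * M)%R) by (generalize PI_RGT_0; nra).
  set (K := (4 * PI * M)%R) in *.
  (* This radius makes [Rabs (A r) * s] exceed [K * r], against
     [Rabs (A r) * s = Rabs (A s) * r <= K * r]. *)
  set (s := ((K * r) / Rabs (A r) + r + 1)%R).
  assert (Hs : (r < s)%R).
  { unfold s; assert (0 <= K * r / Rabs (A r))%R
      by (apply Rdiv_le_0_compat; [nra|exact Hpos]); lra. }
  specialize (Hconst s Hs).
  assert (E : (Rabs (A s) * r = Rabs (A r) * s)%R).
  { rewrite <- (Rabs_right r) at 1 by lra. rewrite <- (Rabs_right s) at 2 by lra.
    rewrite <- !Rabs_mult; f_equal.
    replace (A s) with (A s / s * s)%R by (field; lra).
    rewrite <- Hconst; field; lra. }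
  assert (E2 : (Rabs (A r) * s = K * r + Rabs (A r) * (r + 1))%R)
    by (unfold s; field; lra).
  assert (E3 := A_bound s); fold K in E3. nra.
Qed.

(** The circle of radius 0 is the constant path at [z0], so [B 0] is 2π times the wanted value; and
    [B 0] is the derivative at 0 of [A], which vanishes for all r >= 0. *)
Lemma bounded_C1_Re_derive : Re (C_derive f z0) = 0%R.
Proof.
  assert (HB : B 0 = (2 * PI * Re (C_derive f z0))%R).
  { unfold B; rewrite (RInt_ext _ (fun _ => Re (C_derive f z0))).
    - rewrite RInt_const; unfold scal; simpl; unfold mult; simpl; ring.
    - intros t _; unfold p, g; f_equal; f_equal.
      rewrite (surjective_pairing z0) at 3; unfold Re, Im; f_equal; ring. }
  assert (H0 : B 0 = 0%R).
  { assert (HA := A_derive 0); apply is_derive_Reals in HA.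
    apply NNPP; intros Hne.
    destruct (HA (Rabs (B 0)) (Rabs_pos_lt _ Hne)) as [d Hd].
    assert (Hd0 := cond_pos d).
    (* The increment is taken to the right, since [A_zero] concerns positive radii. *)
    specialize (Hd (d / 2)%R ltac:(lra) ltac:(rewrite Rabs_right; lra)).
    rewrite Rplus_0_l, A_zero, (A_eq 0) in Hd by lra.
    replace ((0 - 0 * B 0) / (d / 2) - B 0)%R with (- B 0)%R in Hd by (field; lra).
    rewrite Rabs_Ropp in Hd; lra. }
  generalize PI_RGT_0; intros HPI.
  rewrite HB in H0; apply Rmult_integral in H0; destruct H0; [lra|easy].
Qed.

End Circle.

(** The real-part lemma for [f] and for [- Ci * f] kills both parts of the derivative; along the
    segment from [0] to [z] both coordinates of [f] are then constant. *)
Theorem liouville_C1 (f : C -> C) (M : R) :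
  (forall z, exists d, C1 f z d) -> (forall z, (Cmod (f z) <= M)%R) ->
  forall z, f z = f 0.
Proof.
  intros Hf HM z.
  assert (C1f : forall z, C1 f z (C_derive f z)).
  { intros u; destruct (Hf u) as [d Hd]; now rewrite (C1_C_derive f u d Hd). }
  assert (H0 : forall u, C_derive f u = 0).
  { intros u.
    assert (HRe := bounded_C1_Re_derive f u M Hf HM).
    assert (HIm : Re (C_derive (fun x => - Ci * f x) u) = 0%R).
    { apply bounded_C1_Re_derive with M.
      - intros x; destruct (Hf x) as [d Hd]; eexists; apply C1_scal; exact Hd.
      - intros x; rewrite Cmod_mult, Cmod_opp, Cmod_Ci, Rmult_1_l; apply HM. }
    rewrite (C1_C_derive _ u _ (C1_scal (- Ci) f u _ (C1f u))) in HIm.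
    destruct (C_derive f u) as [a b].
    unfold Re, Cmult, Copp, Ci in HRe, HIm; simpl in HRe, HIm.
    apply injective_projections; simpl; lra. }
  destruct z as [a b].
  assert (Hx : forall t : R, is_derive (fun s => s * a)%R t a)
    by (intros t; auto_derive; [easy|ring]).
  assert (Hy : forall t : R, is_derive (fun s => s * b)%R t b)
    by (intros t; auto_derive; [easy|ring]).
  assert (E1 : Re (f (0 * a, 0 * b)%R) = Re (f (1 * a, 1 * b)%R)).
  { apply (eq_is_derive (fun t => Re (f (t * a, t * b)%R)) 0 1); [|lra].
    intros t _.
    assert (H := is_derive_Re_comp f _ _ t _ _ _ (C1f _) (Hx t) (Hy t)).
    rewrite H0, Cmult_0_l in H; exact H. }
  assert (E2 : Im (f (0 * a, 0 * b)%R) = Im (f (1 * a, 1 * b)%R)).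
  { apply (eq_is_derive (fun t => Im (f (t * a, t * b)%R)) 0 1); [|lra].
    intros t _.
    assert (H := is_derive_Im_comp f _ _ t _ _ _ (C1f _) (Hx t) (Hy t)).
    rewrite H0, Cmult_0_l in H; exact H. }
  rewrite !Rmult_0_l, !Rmult_1_l in E1, E2.
  now apply injective_projections; symmetry.
Qed.

(** * Lattices *)

(** Discrete comparison with the integral of x^(-3/2). With a = √x and b = √(x+1) one has b² - a² =
    1, so the right side is 2/(ab(a+b)), and a(a+b) <= 2b². *)
Lemma inv_pow_3_2_le_telescope (n : nat) :
  (/ (INR (S n + 1) * sqrt (INR (S n + 1)))
   <= 2 / sqrt (INR (n + 1)) - 2 / sqrt (INR (S n + 1)))%R.
Proof.
  assert (Hx : (1 <= INR (n + 1))%R)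
    by (rewrite plus_INR; simpl; generalize (pos_INR n); lra).
  assert (Hy : INR (S n + 1) = (INR (n + 1) + 1)%R)
    by (rewrite !plus_INR, S_INR; simpl; ring).
  rewrite Hy; set (x := INR (n + 1)) in *; clearbody x; clear Hy.
  set (a := sqrt x); set (b := sqrt (x + 1)).
  assert (Ha : (0 < a)%R) by (apply sqrt_lt_R0; lra).
  assert (Hb : (0 < b)%R) by (apply sqrt_lt_R0; lra).
  assert (Ha2 : (a * a = x)%R) by (apply sqrt_sqrt; lra).
  assert (Hb2 : (b * b = x + 1)%R) by (apply sqrt_sqrt; lra).
  assert (Hab : (a < b)%R) by (apply sqrt_lt_1; lra).
  rewrite <- Hb2.
  replace (2 / a - 2 / b)%R with (2 / (a * b * (a + b)))%R.
  - apply Rmult_le_reg_r with (b * b * b * (a * b * (a + b)))%R.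
    { repeat apply Rmult_lt_0_compat; lra. }
    replace (/ (b * b * b) * (b * b * b * (a * b * (a + b))))%R
      with (a * b * (a + b))%R by (field; lra).
    replace (2 / (a * b * (a + b)) * (b * b * b * (a * b * (a + b))))%R
      with (b * (2 * (b * b)))%R by (field; lra).
    replace (a * b * (a + b))%R with (b * (a * (a + b)))%R by ring.
    apply Rmult_le_compat_l; nra.
  - replace 2%R with (2 * (b * b - a * a))%R at 2 3 by (rewrite Ha2, Hb2; ring).
    replace (2 / (a * b * (a + b)))%R
      with (2 * (b * b - a * a) / (a * b * (a + b)))%R
      by (rewrite Ha2, Hb2; f_equal; ring).
    field_simplify_eq; [|lra].
    replace (2 * (b * b - a * a))%R with (2 * 1)%R by (rewrite Ha2, Hb2; ring).
    nra.
Qed.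

(** This is (1+|m|)^(-3/2). The exponent is half of 3, so that the cube of the modulus can be shared
    between the two coordinates, and it exceeds 1, so that the sum over the integers converges. *)
Definition phi32 (m : Z) : R := (/ ((IZR (Z.abs m) + 1) * sqrt (IZR (Z.abs m) + 1)))%R.

(** The integer 0 is listed twice. This is harmless: the list only serves to bound nonnegative sums
    from above. *)
Definition zrange (n : nat) : list Z :=
  map Z.of_nat (seq 0 (S n)) ++ map (fun k => (- Z.of_nat k)%Z) (seq 0 (S n)).

Lemma in_zrange (n : nat) (m : Z) : (Z.abs m <= Z.of_nat n)%Z -> In m (zrange n).
Proof.
  intros H; unfold zrange; apply in_or_app.
  destruct (Z.le_gt_cases 0 m).
  - left; apply in_map_iff; exists (Z.to_nat m); split; [lia|].
    apply in_seq; lia.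
  - right; apply in_map_iff; exists (Z.to_nat (- m)); split; [lia|].
    apply in_seq; lia.
Qed.

Lemma rsum_map {I J : Type} (h : I -> J) (g : J -> R) (l : list I) :
  rsum g (map h l) = rsum (fun x => g (h x)) l.
Proof. unfold rsum; now rewrite map_map. Qed.

(** Induction by telescoping. The constant 3 comes from [n = 0], where the sum is 1 and [2 / sqrt 1]
    is 2. *)
Lemma rsum_phi32_seq (n : nat) :
  (rsum (fun k => phi32 (Z.of_nat k)) (seq 0 (S n)) <= 3 - 2 / sqrt (INR (n + 1)))%R.
Proof.
  assert (Hphi : forall k, phi32 (Z.of_nat k)
            = (/ (INR (k + 1) * sqrt (INR (k + 1))))%R).
  { intros k; unfold phi32.
    rewrite Z.abs_eq, <- INR_IZR_INZ, plus_INR by lia; easy. }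
  induction n as [|n IH].
  - change (rsum (fun k => phi32 (Z.of_nat k)) (seq 0 1))
      with (phi32 (Z.of_nat 0) + 0)%R.
    rewrite (Hphi 0%nat); simpl; rewrite sqrt_1; lra.
  - rewrite (seq_S (S n) 0), rsum_app.
    change (rsum (fun k => phi32 (Z.of_nat k)) ((0 + S n)%nat :: nil))
      with (phi32 (Z.of_nat (S n)) + 0)%R.
    rewrite (Hphi (S n)); generalize (inv_pow_3_2_le_telescope n); lra.
Qed.

Lemma rsum_phi32_zrange (n : nat) : (rsum phi32 (zrange n) <= 6)%R.
Proof.
  unfold zrange; rewrite rsum_app, !rsum_map.
  assert (H := rsum_phi32_seq n).
  assert (E : rsum (fun k => phi32 (- Z.of_nat k)) (seq 0 (S n))
              = rsum (fun k => phi32 (Z.of_nat k)) (seq 0 (S n))).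
  { unfold rsum; f_equal; apply map_ext; intros k; unfold phi32.
    now rewrite Z.abs_opp. }
  rewrite E.
  assert (Hs : (0 < sqrt (INR (n + 1)))%R)
    by (apply sqrt_lt_R0; rewrite plus_INR; simpl; generalize (pos_INR n); lra).
  assert (0 < 2 / sqrt (INR (n + 1)))%R by (apply Rdiv_lt_0_compat; lra).
  lra.
Qed.

Lemma rsum_prod {I J : Type} (f : I -> R) (g : J -> R) (l : list I) (l' : list J) :
  rsum (fun x => f (fst x) * g (snd x))%R (list_prod l l') = (rsum f l * rsum g l')%R.
Proof.
  induction l as [|x l IH]; simpl.
  - unfold rsum; simpl; ring.
  - rewrite rsum_app, IH, rsum_map; simpl.
    rewrite rsum_scal; change (rsum f (x :: l)) with (f x + rsum f l)%R; ring.
Qed.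

Lemma phi32_pos (m : Z) : (0 < phi32 m)%R.
Proof.
  assert (H : (0 <= IZR (Z.abs m))%R) by (apply IZR_le; lia).
  apply Rinv_0_lt_compat, Rmult_lt_0_compat; [lra|apply sqrt_lt_R0; lra].
Qed.

Lemma inv_cube_nonneg (x : C) : (0 <= / Cmod x ^ 3)%R.
Proof.
  destruct (Req_dec (Cmod x) 0) as [->|H].
  - rewrite pow_i, Rinv_0 by lia; lra.
  - left; apply Rinv_0_lt_compat, pow_lt; generalize (Cmod_ge_0 x); lra.
Qed.

(** * Lattice geometry, convergence and periodic functions *)

Section Lattice.

Variables w1 w2 : C.
Hypothesis Hw : (Re w1 * Im w2 - Im w1 * Re w2 <> 0)%R.

Notation L := (lattice w1 w2).

Notation L' := (fun x : C => L x /\ x <> 0).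

Lemma lattice_0 : L 0.
Proof. exists 0%Z, 0%Z; ring. Qed.

Lemma lattice_plus (x y : C) : L x -> L y -> L (x + y).
Proof.
  intros [a [b ->]] [c [d ->]]; exists (a + c)%Z, (b + d)%Z.
  rewrite !plus_IZR, !RtoC_plus; ring.
Qed.

Lemma lattice_opp (x : C) : L x -> L (- x).
Proof.
  intros [a [b ->]]; exists (- a)%Z, (- b)%Z; rewrite !opp_IZR, !RtoC_opp; ring.
Qed.

Lemma lattice_minus (x y : C) : L x -> L y -> L (x - y).
Proof. intros Hx Hy; exact (lattice_plus _ _ Hx (lattice_opp _ Hy)). Qed.

Lemma lattice_shift (x y : C) : L x -> L (y + x) -> L y.
Proof.
  intros Hx Hy; replace y with (y + x - x) by ring; now apply lattice_minus.
Qed.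

(** Cramer's rule: up to sign, the coordinates times the determinant are the cross products of the
    vector with [w2] and [w1], and a cross product is at most twice the product of the moduli. *)
Lemma coordinates_bound :
  exists k, (0 < k)%R /\ forall s t : R,
    (Rabs s + Rabs t <= k * Cmod (s * w1 + t * w2))%R.
Proof.
  set (D := (Re w1 * Im w2 - Im w1 * Re w2)%R) in *.
  assert (HD : (0 < Rabs D)%R) by now apply Rabs_pos_lt.
  assert (H1 := Cmod_ge_0 w1); assert (H2 := Cmod_ge_0 w2).
  exists (2 * (Cmod w1 + Cmod w2 + 1) / Rabs D)%R.
  split; [apply Rdiv_lt_0_compat; lra|]; intros s t.
  set (u := s * w1 + t * w2).
  assert (Hcross : forall v : C,
            (Rabs (Re u * Im v - Im u * Re v) <= 2 * (Cmod u * Cmod v))%R).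
  { intros v.
    assert (Hc : forall c : C, (Rabs (Re c) <= Cmod c /\ Rabs (Im c) <= Cmod c)%R).
    { intros c; split; (eapply Rle_trans; [|apply Rmax_Cmod]); [apply Rmax_l|apply Rmax_r]. }
    destruct (Hc u) as [A1 A2]; destruct (Hc v) as [A3 A4].
    eapply Rle_trans; [apply Rabs_triang|]; rewrite Rabs_Ropp, !Rabs_mult.
    generalize (Rabs_pos (Re u)) (Rabs_pos (Im u)) (Rabs_pos (Re v)) (Rabs_pos (Im v)).
    intros.
    assert (Rabs (Re u) * Rabs (Im v) <= Cmod u * Cmod v)%R
      by (apply Rmult_le_compat; lra).
    assert (Rabs (Im u) * Rabs (Re v) <= Cmod u * Cmod v)%R
      by (apply Rmult_le_compat; lra).
    lra. }
  assert (Es : (Re u * Im w2 - Im u * Re w2 = s * D)%R)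
    by (unfold u, D, Re, Im, Cplus, Cmult, RtoC; simpl; ring).
  assert (Et : (Re u * Im w1 - Im u * Re w1 = - t * D)%R)
    by (unfold u, D, Re, Im, Cplus, Cmult, RtoC; simpl; ring).
  assert (Ks := Hcross w2); assert (Kt := Hcross w1).
  rewrite Es, Rabs_mult in Ks; rewrite Et, Rabs_mult, Rabs_Ropp in Kt.
  apply Rmult_le_reg_r with (Rabs D); [exact HD|].
  replace (2 * (Cmod w1 + Cmod w2 + 1) / Rabs D * Cmod u * Rabs D)%R
    with (2 * (Cmod w1 + Cmod w2 + 1) * Cmod u)%R by (field; lra).
  generalize (Cmod_ge_0 u); nra.
Qed.

Lemma lattice_discrete :
  exists c, (0 < c)%R /\ forall x, L x -> x <> 0 -> (c <= Cmod x)%R.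
Proof.
  destruct coordinates_bound as [k [Hk H]].
  exists (/ k)%R; split; [now apply Rinv_0_lt_compat|].
  intros x [a [b ->]] Hx.
  assert (K := H (IZR a) (IZR b)).
  assert (H1 : (1 <= Rabs (IZR a) + Rabs (IZR b))%R).
  { rewrite <- !abs_IZR, <- plus_IZR; apply IZR_le.
    assert (a <> 0 \/ b <> 0)%Z; [|lia].
    apply NNPP; intros Hn; apply Hx.
    assert (a = 0%Z) as -> by tauto; assert (b = 0%Z) as -> by tauto; ring. }
  apply Rmult_le_reg_l with k; [exact Hk|].
  rewrite Rinv_r; lra.
Qed.

(* The cubic term is dominated by a product in the two coordinates, because
   [4 (|a| + |b|)^2 >= (1 + |a|) (1 + |b|)] unless [a = b = 0]. *)
Lemma lattice_sum_inv_cube_bound :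
  exists M, forall l, finite_subset L' l ->
    (rsum (fun x => / Cmod x ^ 3)%R l <= M)%R.
Proof.
  destruct coordinates_bound as [k [Hk Hcoord]].
  assert (Hterm : forall a b : Z,
            (/ Cmod (IZR a * w1 + IZR b * w2)%C ^ 3 <= 8 * k ^ 3 * (phi32 a * phi32 b))%R).
  { intros a b; assert (K := Hcoord (IZR a) (IZR b)).
    set (x := IZR a * w1 + IZR b * w2) in *.
    assert (Hp := Rmult_lt_0_compat _ _ (phi32_pos a) (phi32_pos b)).
    assert (Hk3 : (0 < k ^ 3)%R) by now apply pow_lt.
    (* At the origin the left side is [/ 0], which is 0 by convention. This lets the bound run over
       a whole box of integer pairs. *)
    destruct (classic (a = 0%Z /\ b = 0%Z)) as [[Ha Hb]|Hab].
    - replace x with (RtoC 0) by (unfold x; rewrite Ha, Hb; ring).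
      rewrite Cmod_0, pow_i, Rinv_0 by lia. nra.
    - rewrite <- !abs_IZR in K.
      unfold phi32 in *.
      assert (H1 : (1 <= IZR (Z.abs a) + IZR (Z.abs b))%R)
        by (rewrite <- plus_IZR; apply IZR_le; lia).
      assert (Ha : (0 <= IZR (Z.abs a))%R) by (apply IZR_le; lia).
      assert (Hb : (0 <= IZR (Z.abs b))%R) by (apply IZR_le; lia).
      set (p := IZR (Z.abs a)) in *; set (q := IZR (Z.abs b)) in *.
      clearbody p q x; clear a b Hab.
      set (m := Cmod x) in *.
      assert (Hm : (0 < m)%R) by nra.
      set (s := sqrt (p + 1)) in *; set (t := sqrt (q + 1)) in *.
      assert (Hs : (0 < s)%R) by (apply sqrt_lt_R0; lra).
      assert (Ht : (0 < t)%R) by (apply sqrt_lt_R0; lra).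
      assert (Es : (s * s = p + 1)%R) by (apply sqrt_sqrt; lra).
      assert (Et : (t * t = q + 1)%R) by (apply sqrt_sqrt; lra).
      assert (Hst : (s * t <= 2 * (k * m))%R).
      { apply Rle_trans with (2 * (p + q))%R; [|lra].
        apply Rsqr_incr_0_var; [unfold Rsqr|lra].
        replace (s * t * (s * t))%R with ((p + 1) * (q + 1))%R
          by (rewrite <- Es, <- Et; ring).
        nra. }
      rewrite <- Es, <- Et.
      replace (/ (s * s * s) * / (t * t * t))%R with (/ (s * t) ^ 3)%R
        by (field; lra).
      assert (Hst0 : (0 < s * t)%R) by now apply Rmult_lt_0_compat.
      assert (Hst3 : (0 < (s * t) ^ 3)%R) by now apply pow_lt.
      assert (Hm3 : (0 < m ^ 3)%R) by now apply pow_lt.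
      assert (Hcube : ((s * t) ^ 3 <= (2 * (k * m)) ^ 3)%R)
        by (apply pow_incr; lra).
      apply Rmult_le_reg_r with (m ^ 3 * (s * t) ^ 3)%R; [now apply Rmult_lt_0_compat|].
      replace (/ m ^ 3 * (m ^ 3 * (s * t) ^ 3))%R with ((s * t) ^ 3)%R by (field; lra).
      replace (8 * k ^ 3 * / (s * t) ^ 3 * (m ^ 3 * (s * t) ^ 3))%R
        with ((2 * (k * m)) ^ 3)%R by (field; lra).
      exact Hcube. }
  assert (Hk3 : (0 < k ^ 3)%R) by now apply pow_lt.
  (* [36] is [6 * 6], one factor for each coordinate; it does not depend on the box that contains
     [l]. *)
  exists (8 * k ^ 3 * 36)%R; intros l [Hnd Hl].
  set (pt := fun ab : Z * Z => IZR (fst ab) * w1 + IZR (snd ab) * w2).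
  assert (Hbox : exists n, incl l (map pt (list_prod (zrange n) (zrange n)))).
  { clear Hnd; induction l as [|x l IH].
    - exists 0%nat; easy.
    - destruct IH as [n Hn]; [intros y Hy; apply Hl; now right|].
      destruct (Hl x (or_introl eq_refl)) as [[a [b E]] _].
      exists (n + Z.to_nat (Z.abs a) + Z.to_nat (Z.abs b))%nat.
      intros y [<-|Hy].
      + apply in_map_iff; exists (a, b); split; [now rewrite E|].
        apply in_prod; apply in_zrange; lia.
      + apply Hn in Hy; apply in_map_iff in Hy.
        destruct Hy as [[c d] [<- Hcd]].
        apply in_map_iff; exists (c, d); split; [easy|].
        apply in_prod_iff in Hcd; destruct Hcd as [Hc Hd].
        assert (Hrange : forall e, In e (zrange n) -> (Z.abs e <= Z.of_nat n)%Z).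
        { intros e He; unfold zrange in He; apply in_app_or in He.
          destruct He as [He|He]; apply in_map_iff in He;
            destruct He as [j [<- Hj]]; apply in_seq in Hj; lia. }
        apply Hrange in Hc; apply Hrange in Hd.
        apply in_prod; apply in_zrange; lia. }
  destruct Hbox as [n Hn].
  apply Rle_trans with (rsum (fun x => / Cmod x ^ 3)%R
                          (map pt (list_prod (zrange n) (zrange n)))).
  { apply rsum_incl; [exact Hnd|exact Hn|]; intros x _.
    apply inv_cube_nonneg. }
  rewrite rsum_map.
  apply Rle_trans with
    (rsum (fun ab => 8 * k ^ 3 * (phi32 (fst ab) * phi32 (snd ab)))%R
       (list_prod (zrange n) (zrange n))).
  { apply rsum_le; intros [a b] _; apply Hterm. }
  rewrite rsum_scal, rsum_prod.
  apply Rmult_le_compat_l; [lra|].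
  assert (H6 := rsum_phi32_zrange n).
  assert (H0 : (0 <= rsum phi32 (zrange n))%R)
    by (apply rsum_nonneg; intros; left; apply phi32_pos).
  nra.
Qed.

(** By periodicity it is enough to bound [f] on the compact parallelogram of coordinates in [0,1].
    Compactness is available as a positive lower bound for a gauge of radii; tying the local bound
    of [f] to the inverse radius turns it into an upper bound for [f]. *)
Lemma periodic_continuous_bounded (f : C -> C) :
  (forall z eps, (0 < eps)%R -> exists s, (0 < s)%R /\
     forall u, (Cmod (u - z) < s)%R -> (Cmod (f u - f z) < eps)%R) ->
  (forall x z, L x -> f (z + x) = f z) ->
  exists M, forall z, (Cmod (f z) <= M)%R.
Proof.
  intros Hf Hper.
  set (pt := fun s t : R => s * w1 + t * w2).
  (* A radius on which [f] is bounded by the inverse of that radius. *)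
  assert (Hrad : forall s t : R, exists d : posreal, forall s' t',
            (Rabs (s' - s) < d)%R -> (Rabs (t' - t) < d)%R ->
            (Cmod (f (pt s' t')) <= / d)%R).
  { intros s t; destruct (Hf (pt s t) 1%R Rlt_0_1) as [r [Hr H]].
    set (W := (Cmod w1 + Cmod w2 + 1)%R).
    assert (HW : (0 < W)%R)
      by (unfold W; generalize (Cmod_ge_0 w1) (Cmod_ge_0 w2); lra).
    set (K := (Cmod (f (pt s t)) + 1)%R).
    assert (HK : (0 < K)%R) by (unfold K; generalize (Cmod_ge_0 (f (pt s t))); lra).
    assert (Hd : (0 < Rmin (r / W) (/ K))%R)
      by (apply Rmin_glb_lt; [now apply Rdiv_lt_0_compat|now apply Rinv_0_lt_compat]).
    exists (mkposreal _ Hd); simpl; intros s' t' Hs Ht.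
    generalize (Rmin_l (r / W) (/ K)) (Rmin_r (r / W) (/ K)).
    set (d := Rmin (r / W) (/ K)) in *; intros Hl Hr'.
    apply Rle_trans with K.
    - replace (f (pt s' t')) with (f (pt s' t') - f (pt s t) + f (pt s t)) by ring.
      eapply Rle_trans; [apply Cmod_triangle|].
      unfold K; rewrite Rplus_comm; apply Rplus_le_compat_l; left; apply H.
      replace (pt s' t' - pt s t) with (RtoC (s' - s) * w1 + RtoC (t' - t) * w2)
        by (unfold pt; rewrite !RtoC_minus; ring).
      eapply Rle_lt_trans; [apply Cmod_triangle|]; rewrite !Cmod_mult, !Cmod_R.
      assert (HdW : (d * W <= r)%R).
      { apply Rle_trans with (r / W * W)%R; [apply Rmult_le_compat_r; lra|].
        right; field; lra. }
      generalize (Cmod_ge_0 w1) (Cmod_ge_0 w2); unfold W in HdW; nra.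
    - rewrite <- (Rinv_inv K); apply Rinv_le_contravar; lra. }
  destruct (choice (fun st (d : posreal) => forall s' t',
              (Rabs (s' - fst st) < d)%R -> (Rabs (t' - snd st) < d)%R ->
              (Cmod (f (pt s' t')) <= / d)%R)) as [delta Hdelta].
  { intros [s t]; apply Hrad. }
  destruct (compactness_value_2d 0 1 0 1 (fun s t => delta (s, t))) as [d Hd].
  exists (/ d)%R; intros z.
  assert (Hz : exists s t : R, z = pt s t).
  { set (D := (Re w1 * Im w2 - Im w1 * Re w2)%R) in *.
    exists ((Re z * Im w2 - Im z * Re w2) / D)%R, ((Im z * Re w1 - Re z * Im w1) / D)%R.
    unfold pt, D, Re, Im in *; destruct z as [? ?], w1 as [? ?], w2 as [? ?]; simpl in *.
    unfold Cplus, Cmult, RtoC; simpl; f_equal; field; exact Hw. }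
  destruct Hz as [s [t ->]].
  destruct (base_Int_part s) as [Hs1 Hs2]; destruct (base_Int_part t) as [Ht1 Ht2].
  set (a := Int_part s) in *; set (b := Int_part t) in *.
  replace (pt s t) with (pt (s - IZR a)%R (t - IZR b)%R + (IZR a * w1 + IZR b * w2))
    by (unfold pt; rewrite !RtoC_minus; ring).
  rewrite Hper by (now exists a, b).
  (* [compactness_value_2d] yields its covering point under a double negation, hence the argument by
     contradiction. *)
  apply Rnot_lt_le; intros Hlt.
  apply (Hd (s - IZR a)%R (t - IZR b)%R); [lra|lra|].
  intros [u [v [_ [_ [Hu [Hv Hduv]]]]]].
  assert (K := Hdelta (u, v) _ _ Hu Hv).
  assert (/ delta (u, v) <= / d)%R by (apply Rinv_le_contravar; [apply cond_pos|exact Hduv]).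
  lra.
Qed.

End Lattice.

(** * The function ℘, the zeta function and their difference quotients *)

Lemma Cinv_0 : / (0 : C) = 0.
Proof. unfold Cinv, RtoC; simpl; f_equal; unfold Rdiv; ring. Qed.

Section Weierstrass.

Variables w1 w2 : C.
Hypothesis Hw : (Re w1 * Im w2 - Im w1 * Re w2 <> 0)%R.

Notation L := (lattice w1 w2).
Notation L' := (fun x : C => L x /\ x <> 0).

Definition regular (a : C) : Prop := forall x, L x -> x <> 0 -> a + x <> 0.

Lemma regular_not_lattice (a : C) : ~ L a -> regular a.
Proof.
  intros Ha x Hx _ E; apply Ha; replace a with (a + x - x) by ring.
  rewrite E; apply lattice_minus; [apply lattice_0|exact Hx].
Qed.

Lemma regular_0 : regular 0.
Proof. intros x _ Hx E; apply Hx; rewrite <- E; ring. Qed.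

Lemma not_lattice_neq_0 (a : C) : ~ L a -> a <> 0.
Proof. intros Ha ->; apply Ha, lattice_0. Qed.

Lemma not_lattice_regular (a : C) : regular a -> a <> 0 -> ~ L a.
Proof.
  intros Ha H0 HL; apply (Ha (- a)).
  - now apply lattice_opp.
  - intros E; apply H0; replace a with (- - a) by ring; rewrite E; ring.
  - ring.
Qed.

Lemma regular_opp (a : C) : regular a -> regular (- a).
Proof.
  intros Ha x Hx H0 E; apply (Ha (- x)).
  - now apply lattice_opp.
  - intros E'; apply H0; replace x with (- - x) by ring; rewrite E'; ring.
  - replace (a + - x) with (- (- a + x)) by ring; rewrite E; ring.
Qed.

Lemma not_lattice_opp (a : C) : ~ L a -> ~ L (- a).
Proof.
  intros Ha H; apply Ha; replace a with (- - a) by ring; now apply lattice_opp.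
Qed.

(* Two distinct lattice points are at distance at least [c], so at most one of
   them is within [c / 2] of [- a]. *)
Lemma regular_separated (a : C) :
  regular a -> exists d, (0 < d)%R /\ forall x, L x -> x <> 0 -> (d <= Cmod (a + x))%R.
Proof.
  intros Ha; destruct (lattice_discrete w1 w2 Hw) as [c [Hc Hdisc]].
  destruct (classic (exists x, L x /\ x <> 0 /\ (Cmod (a + x) < c / 2)%R))
    as [[y [Hy [Hy0 Hya]]]|Hno].
  - assert (Hpos : (0 < Cmod (a + y))%R) by now apply Cmod_gt_0, Ha.
    exists (Cmod (a + y)); split; [exact Hpos|]; intros x Hx Hx0.
    destruct (classic (x = y)) as [->|Hxy]; [lra|].
    assert (H : (c <= Cmod (x - y))%R).
    { apply Hdisc; [now apply lattice_minus|].
      intros E; apply Hxy; replace x with (x - y + y) by ring; rewrite E; ring. }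
    assert (H' : (Cmod (x - y) <= Cmod (a + x) + Cmod (a + y))%R).
    { rewrite <- (Cmod_opp (a + y)).
      replace (x - y) with (a + x + - (a + y)) by ring; apply Cmod_triangle. }
    lra.
  - exists (c / 2)%R; split; [lra|]; intros x Hx Hx0.
    apply Rnot_lt_le; intros H; apply Hno; now exists x.
Qed.

(** If [d] separates [-a] from the nonzero lattice points, then |x| <= |a+x| + |a| <= (1 + |a|/d)
    |a+x|. Moving [a] by less than d/2 costs at most a factor 2. *)
Lemma regular_inv_bound (a : C) :
  regular a -> exists K d, (0 < K)%R /\ (0 < d)%R /\
    forall u, (Cmod (u - a) < d)%R -> regular u /\
      forall x, L x -> x <> 0 -> (Cmod (/ (u + x)) <= K * / Cmod x)%R.
Proof.
  intros Ha; destruct (regular_separated a Ha) as [d [Hd Hsep]].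
  exists (2 * (1 + Cmod a / d))%R, (d / 2)%R.
  assert (H0 : (0 <= Cmod a / d)%R) by (apply Rdiv_le_0_compat; [apply Cmod_ge_0|lra]).
  split; [lra|]; split; [lra|]; intros u Hu.
  assert (Hux : forall x, L x -> x <> 0 -> (Cmod (a + x) / 2 < Cmod (u + x))%R).
  { intros x Hx Hx0; specialize (Hsep x Hx Hx0).
    assert (Cmod (a + x) <= Cmod (u + x) + Cmod (u - a))%R; [|lra].
    rewrite <- (Cmod_opp (u - a)).
    replace (a + x) with (u + x + - (u - a)) by ring; apply Cmod_triangle. }
  assert (Hreg : regular u).
  { intros x Hx Hx0; apply Cmod_gt_0.
    specialize (Hux x Hx Hx0); specialize (Hsep x Hx Hx0); lra. }
  split; [exact Hreg|]; intros x Hx Hx0.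
  specialize (Hsep x Hx Hx0); specialize (Hux x Hx Hx0).
  assert (Hx' : (0 < Cmod x)%R) by now apply Cmod_gt_0.
  rewrite Cmod_inv by now apply Hreg.
  assert (Hxa : (Cmod x <= (1 + Cmod a / d) * Cmod (a + x))%R).
  { apply Rle_trans with (Cmod (a + x) + Cmod a)%R.
    - rewrite <- (Cmod_opp a).
      replace x with (a + x + - a) at 1 by ring; apply Cmod_triangle.
    - assert (Cmod a <= Cmod a / d * Cmod (a + x))%R; [|lra].
      apply Rle_trans with (Cmod a / d * d)%R; [right; field; lra|].
      apply Rmult_le_compat_l; lra. }
  apply Rmult_le_reg_r with (Cmod (u + x) * Cmod x)%R; [apply Rmult_lt_0_compat; lra|].
  replace (/ Cmod (u + x) * (Cmod (u + x) * Cmod x))%R with (Cmod x) by (field; lra).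
  replace (2 * (1 + Cmod a / d) * / Cmod x * (Cmod (u + x) * Cmod x))%R
    with (2 * (1 + Cmod a / d) * Cmod (u + x))%R by (field; lra).
  nra.
Qed.

Lemma not_lattice_near (z : C) :
  ~ L z -> exists r, (0 < r)%R /\ forall u, (Cmod (u - z) < r)%R -> ~ L u.
Proof.
  intros Hz.
  destruct (regular_inv_bound z (regular_not_lattice z Hz)) as [K [d [_ [Hd H]]]].
  assert (Hz0 : (0 < Cmod z)%R) by now apply Cmod_gt_0, not_lattice_neq_0.
  exists (Rmin d (Cmod z)); split; [now apply Rmin_glb_lt|]; intros u Hu.
  generalize (Rmin_l d (Cmod z)) (Rmin_r d (Cmod z)); intros Hl Hr.
  apply not_lattice_regular; [apply H; lra|].
  intros ->; replace (0 - z) with (- z) in Hu by ring; rewrite Cmod_opp in Hu; lra.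
Qed.

(** [M] is fixed before [f] and [K], so that a termwise bound with small [K] makes the whole sum
    small; the continuity of [E3] uses this. *)
Lemma inv_cube_majorant :
  exists M, (0 <= M)%R /\ forall (f : C -> C) (K : R), (0 <= K)%R ->
    (forall x, L x -> x <> 0 -> (Cmod (f x) <= K * / Cmod x ^ 3)%R) ->
    (exists s, is_unordered_sum L' f s) /\
    (forall s, is_unordered_sum L' f s -> (Cmod s <= K * M)%R).
Proof.
  destruct (lattice_sum_inv_cube_bound w1 w2 Hw) as [M HM].
  exists M; split.
  { apply (HM nil); split; [constructor|easy]. }
  intros f K HK Hf.
  assert (Hf' : forall x, L' x -> (Cmod (f x) <= K * / Cmod x ^ 3)%R)
    by (intros x [Hx Hx0]; now apply Hf).
  assert (HM' : forall l, finite_subset L' l ->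
            (rsum (fun x => K * / Cmod x ^ 3)%R l <= K * M)%R).
  { intros l Hl; rewrite rsum_scal; apply Rmult_le_compat_l; [exact HK|now apply HM]. }
  split.
  - exact (summable_dominated L' f _ _ Hf' HM').
  - intros s Hs; exact (Cmod_unordered_sum_le L' f _ s _ Hf' HM' Hs).
Qed.

(** * The cubic series and its joint continuity *)

Definition E3 (a b c : C) : C :=
  unordered_sum L' (fun x => / (a + x) * / (b + x) * / (c + x)).

Lemma E3_sum (a b c : C) :
  regular a -> regular b -> regular c ->
  is_unordered_sum L' (fun x => / (a + x) * / (b + x) * / (c + x)) (E3 a b c).
Proof.
  intros Ha Hb Hc.
  destruct (regular_inv_bound a Ha) as [K1 [d1 [HK1 [Hd1 H1]]]].
  destruct (regular_inv_bound b Hb) as [K2 [d2 [HK2 [Hd2 H2]]]].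
  destruct (regular_inv_bound c Hc) as [K3 [d3 [HK3 [Hd3 H3]]]].
  destruct inv_cube_majorant as [M [_ HM]].
  destruct (HM (fun x => / (a + x) * / (b + x) * / (c + x)) (K1 * K2 * K3)%R)
    as [[s Hs] _].
  - repeat apply Rmult_le_pos; lra.
  - intros x Hx Hx0.
    assert (B1 := proj2 (H1 a (Cmod_self a d1 Hd1)) x Hx Hx0).
    assert (B2 := proj2 (H2 b (Cmod_self b d2 Hd2)) x Hx Hx0).
    assert (B3 := proj2 (H3 c (Cmod_self c d3 Hd3)) x Hx Hx0).
    assert (Hx' : (0 < Cmod x)%R) by now apply Cmod_gt_0.
    rewrite !Cmod_mult.
    replace (K1 * K2 * K3 * / Cmod x ^ 3)%R
      with (K1 * / Cmod x * (K2 * / Cmod x) * (K3 * / Cmod x))%R by (field; lra).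
    apply Rmult_le_compat; try apply Cmod_ge_0; try exact B3.
    + apply Rmult_le_pos; apply Cmod_ge_0.
    + apply Rmult_le_compat; try apply Cmod_ge_0; assumption.
  - unfold E3; now rewrite (unordered_sum_eq _ _ s Hs).
Qed.

(** Changing one argument at a time splits the difference of two terms into three, each an increment
    times four inverse factors. These give |x|^(-4); one factor 1/|x| is at most [/ m] by
    discreteness, which leaves the cubic majorant. *)
Lemma E3_continuous (a b c : C) (eps : R) :
  regular a -> regular b -> regular c -> (0 < eps)%R ->
  exists d, (0 < d)%R /\ forall u v w,
    (Cmod (u - a) < d)%R -> (Cmod (v - b) < d)%R -> (Cmod (w - c) < d)%R ->
    (Cmod (E3 u v w - E3 a b c) < eps)%R.
Proof.
  intros Ha Hb Hc He.
  destruct (regular_inv_bound a Ha) as [K1 [d1 [HK1 [Hd1 H1]]]].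
  destruct (regular_inv_bound b Hb) as [K2 [d2 [HK2 [Hd2 H2]]]].
  destruct (regular_inv_bound c Hc) as [K3 [d3 [HK3 [Hd3 H3]]]].
  destruct inv_cube_majorant as [M [HM0 HM]].
  destruct (lattice_discrete w1 w2 Hw) as [m [Hm Hdisc]].
  set (K := (K1 + K2 + K3)%R).
  assert (HK : (0 < K)%R) by (unfold K; lra).
  (* The difference of the sums is at most [(T - 1) * d]; the [+ 1] keeps [T] positive even for
     [M = 0] and makes the final inequality strict. *)
  set (T := (3 * (K ^ 4 * / m) * M + 1)%R).
  assert (HKm : (0 < K ^ 4 * / m)%R)
    by (apply Rmult_lt_0_compat; [now apply pow_lt|now apply Rinv_0_lt_compat]).
  assert (HT : (0 < T)%R) by (unfold T; nra).
  set (d := Rmin (Rmin d1 d2) (Rmin d3 (eps / T))%R).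
  assert (Hd : (0 < d)%R).
  { repeat apply Rmin_glb_lt; try assumption; now apply Rdiv_lt_0_compat. }
  exists d; split; [exact Hd|]; intros u v w Hu Hv Hw'.
  assert (Hdd : (d <= d1 /\ d <= d2 /\ d <= d3 /\ d <= eps / T)%R).
  { unfold d; generalize (Rmin_l (Rmin d1 d2) (Rmin d3 (eps / T)%R))
      (Rmin_r (Rmin d1 d2) (Rmin d3 (eps / T)%R)) (Rmin_l d1 d2) (Rmin_r d1 d2)
      (Rmin_l d3 (eps / T)%R) (Rmin_r d3 (eps / T)%R); lra. }
  destruct Hdd as [Hl1 [Hl2 [Hl3 Hl4]]].
  destruct (H1 u ltac:(lra)) as [Ru Bu]; destruct (H2 v ltac:(lra)) as [Rv Bv].
  destruct (H3 w ltac:(lra)) as [Rw Bw].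
  destruct (H1 a (Cmod_self a d1 Hd1)) as [_ Ba].
  destruct (H2 b (Cmod_self b d2 Hd2)) as [_ Bb].
  destruct (H3 c (Cmod_self c d3 Hd3)) as [_ Bc].
  assert (Hsum := is_unordered_sum_minus _ _ _ _ _ (E3_sum u v w Ru Rv Rw)
                    (E3_sum a b c Ha Hb Hc)).
  destruct (HM (fun x => / (u + x) * / (v + x) * / (w + x)
                         - / (a + x) * / (b + x) * / (c + x))
               (3 * (K ^ 4 * / m) * d)%R) as [_ Hbound].
  - nra.
  - intros x Hx Hx0.
    assert (Hx' : (0 < Cmod x)%R) by now apply Cmod_gt_0.
    set (y := (/ Cmod x)%R).
    assert (Hy : (0 < y)%R) by now apply Rinv_0_lt_compat.
    assert (Hym : (y <= / m)%R) by (apply Rinv_le_contravar; [exact Hm|now apply Hdisc]).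
    assert (Kle : forall k z, (0 < k)%R -> (k <= K)%R -> (Cmod z <= k * / Cmod x)%R ->
              (Cmod z <= K * y)%R).
    { intros k z Hk Hle Hz; eapply Rle_trans; [exact Hz|].
      apply Rmult_le_compat_r; [left; exact Hy|exact Hle]. }
    assert (B1 := Kle K1 _ HK1 ltac:(unfold K; lra) (Bu x Hx Hx0)).
    assert (B2 := Kle K2 _ HK2 ltac:(unfold K; lra) (Bv x Hx Hx0)).
    assert (B3 := Kle K3 _ HK3 ltac:(unfold K; lra) (Bw x Hx Hx0)).
    assert (B4 := Kle K1 _ HK1 ltac:(unfold K; lra) (Ba x Hx Hx0)).
    assert (B5 := Kle K2 _ HK2 ltac:(unfold K; lra) (Bb x Hx Hx0)).
    assert (B6 := Kle K3 _ HK3 ltac:(unfold K; lra) (Bc x Hx Hx0)).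
    assert (Hprod : forall h p q r s : C, (Cmod h < d)%R ->
              (Cmod p <= K * y)%R -> (Cmod q <= K * y)%R ->
              (Cmod r <= K * y)%R -> (Cmod s <= K * y)%R ->
              (Cmod (h * (p * q * r * s)) <= K ^ 4 * / m * d * / Cmod x ^ 3)%R).
    { intros h p q r s Hh Hp Hq Hr Hs; rewrite !Cmod_mult.
      apply Rle_trans with (d * (K * y * (K * y) * (K * y) * (K * y)))%R.
      - apply Rmult_le_compat; try apply Cmod_ge_0; [|lra|].
        + repeat apply Rmult_le_pos; apply Cmod_ge_0.
        + repeat (apply Rmult_le_compat; try assumption);
            repeat apply Rmult_le_pos; apply Cmod_ge_0.
      - replace (/ Cmod x ^ 3)%R with (y ^ 3)%R by (unfold y; field; lra).
        replace (d * (K * y * (K * y) * (K * y) * (K * y)))%R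
          with (K ^ 4 * d * y ^ 3 * y)%R by ring.
        replace (K ^ 4 * / m * d * y ^ 3)%R with (K ^ 4 * d * y ^ 3 * / m)%R by ring.
        apply Rmult_le_compat_l; [|exact Hym].
        repeat apply Rmult_le_pos; try (apply pow_le); lra. }
    replace (/ (u + x) * / (v + x) * / (w + x) - / (a + x) * / (b + x) * / (c + x))
      with (- ((u - a) * (/ (u + x) * / (a + x) * / (v + x) * / (w + x)))
            + (- ((v - b) * (/ (a + x) * / (v + x) * / (b + x) * / (w + x)))
            + - ((w - c) * (/ (a + x) * / (b + x) * / (w + x) * / (c + x)))))
      by (field; repeat split; auto).
    eapply Rle_trans; [apply Cmod_triangle|].
    eapply Rle_trans; [apply Rplus_le_compat_l, Cmod_triangle|].
    rewrite !Cmod_opp.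
    assert (P1 := Hprod (u - a) _ _ _ _ Hu B1 B4 B2 B3).
    assert (P2 := Hprod (v - b) _ _ _ _ Hv B4 B2 B5 B3).
    assert (P3 := Hprod (w - c) _ _ _ _ Hw' B4 B5 B3 B6).
    lra.
  - specialize (Hbound _ Hsum).
    eapply Rle_lt_trans; [exact Hbound|].
    apply Rlt_le_trans with (T * d)%R.
    + unfold T; nra.
    + apply Rle_trans with (T * (eps / T))%R; [apply Rmult_le_compat_l; lra|].
      right; field; lra.
Qed.

Lemma cont2_E3 (P Q S : C -> C -> C) (a b : C) :
  regular (P a b) -> regular (Q a b) -> regular (S a b) ->
  cont2 P a b -> cont2 Q a b -> cont2 S a b ->
  cont2 (fun u v => E3 (P u v) (Q u v) (S u v)) a b.
Proof.
  intros RP RQ RS HP HQ HS eps He.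
  destruct (E3_continuous _ _ _ eps RP RQ RS He) as [d [Hd H]].
  destruct (HP d Hd) as [d1 [Hd1 H1]]; destruct (HQ d Hd) as [d2 [Hd2 H2]].
  destruct (HS d Hd) as [d3 [Hd3 H3]].
  exists (Rmin d1 (Rmin d2 d3)); split; [repeat apply Rmin_glb_lt; assumption|].
  intros u v Hu Hv.
  generalize (Rmin_l d1 (Rmin d2 d3)) (Rmin_r d1 (Rmin d2 d3)) (Rmin_l d2 d3)
    (Rmin_r d2 d3); intros.
  apply H; [apply H1|apply H2|apply H3]; lra.
Qed.

(** * Difference quotients, ℘ and ζ *)

Definition D0 (u v : C) : C :=
  unordered_sum L' (fun x => / (u + x) * / (v + x) - / x * / x).

(** Passes from 1/((u+x)(v+x)) to 1/(x(v+x)) and then to 1/x². Each change gains a factor 1/x, which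
    supplies the cubic decay. *)
Lemma D0_sum_E3 (u v : C) :
  regular u -> regular v ->
  is_unordered_sum L' (fun x => / (u + x) * / (v + x) - / x * / x)
    (- u * E3 u 0 v + - v * E3 0 0 v).
Proof.
  intros Hu Hv.
  eapply is_unordered_sum_ext; [|apply is_unordered_sum_plus;
    apply is_unordered_sum_scal; apply E3_sum; assumption || apply regular_0].
  intros x [Hx Hx0]; cbv beta; rewrite !Cplus_0_l; field; repeat split; auto.
Qed.

Lemma D0_E3 (u v : C) :
  regular u -> regular v -> D0 u v = - u * E3 u 0 v + - v * E3 0 0 v.
Proof. intros Hu Hv; now apply unordered_sum_eq, D0_sum_E3. Qed.

Lemma D0_sum (u v : C) :
  regular u -> regular v ->
  is_unordered_sum L' (fun x => / (u + x) * / (v + x) - / x * / x) (D0 u v).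
Proof. intros Hu Hv; rewrite D0_E3 by assumption; now apply D0_sum_E3. Qed.

Lemma D0_0 : D0 0 0 = 0.
Proof. rewrite D0_E3 by apply regular_0; ring. Qed.

Lemma D0_comm (u v : C) : regular u -> regular v -> D0 u v = D0 v u.
Proof.
  intros Hu Hv; apply unordered_sum_eq.
  eapply is_unordered_sum_ext; [|exact (D0_sum v u Hv Hu)].
  intros x _; cbv beta; ring.
Qed.

Lemma D0_opp (u v : C) : regular u -> regular v -> D0 (- u) (- v) = D0 u v.
Proof.
  intros Hu Hv.
  assert (Hopp : forall x, L' x -> L' (- x)).
  { intros x [Hx Hx0]; split; [now apply lattice_opp|].
    intros E; apply Hx0; replace x with (- - x) by ring; rewrite E; ring. }
  apply unordered_sum_eq.
  eapply is_unordered_sum_ext;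
    [|exact (is_unordered_sum_reindex L' _ _ Copp Copp Hopp Hopp
        ltac:(intros x; cbv beta; ring) ltac:(intros x; cbv beta; ring) (D0_sum u v Hu Hv))].
  intros x [Hx Hx0]; cbv beta.
  assert (Ku := regular_opp u Hu x Hx Hx0); assert (Kv := regular_opp v Hv x Hx Hx0).
  replace (u + - x) with (- (- u + x)) by ring.
  replace (v + - x) with (- (- v + x)) by ring.
  field; repeat split; auto.
Qed.

Lemma D0_minus (u u' v : C) :
  regular u -> regular u' -> regular v ->
  D0 u v - D0 u' v = (u - u') * - E3 u u' v.
Proof.
  intros Hu Hu' Hv.
  refine (is_unordered_sum_unique L' _ _ _
    (is_unordered_sum_minus _ _ _ _ _ (D0_sum u v Hu Hv) (D0_sum u' v Hu' Hv)) _).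
  replace ((u - u') * - E3 u u' v) with (- (u - u') * E3 u u' v) by ring.
  eapply is_unordered_sum_ext; [|apply is_unordered_sum_scal, E3_sum; assumption].
  intros x [Hx Hx0]; cbv beta; field; repeat split; auto.
Qed.

Lemma cont2_D0 (a b : C) : regular a -> regular b -> cont2 D0 a b.
Proof.
  intros Ha Hb.
  destruct (regular_inv_bound a Ha) as [K1 [d1 [_ [Hd1 H1]]]].
  destruct (regular_inv_bound b Hb) as [K2 [d2 [_ [Hd2 H2]]]].
  apply (cont2_ext_near (fun u v => - u * E3 u 0 v + - v * E3 0 0 v) _ a b (Rmin d1 d2)).
  - now apply Rmin_glb_lt.
  - intros u v Hu Hv; generalize (Rmin_l d1 d2) (Rmin_r d1 d2); intros.
    symmetry; apply D0_E3; [apply H1|apply H2]; lra.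
  - assert (R0 := regular_0).
    apply cont2_plus; apply cont2_mult; try apply cont2_opp; try apply cont2_E3;
      try assumption; (apply cont2_fst || apply cont2_snd || apply cont2_const).
Qed.

Lemma C1_D0_l (z v : C) :
  regular z -> regular v -> C1 (fun u => D0 u v) z (- E3 z z v).
Proof.
  intros Hz Hv; destruct (regular_inv_bound z Hz) as [K [d [_ [Hd H]]]].
  exists (fun x y => - E3 x y v), d; split; [exact Hd|]; split; [easy|].
  intros x y Hx Hy; destruct (H x Hx) as [Rx _]; destruct (H y Hy) as [Ry _].
  split; [now apply D0_minus|].
  apply cont2_opp, cont2_E3; try assumption;
    (apply cont2_fst || apply cont2_snd || apply cont2_const).
Qed.

(** The slope along the diagonal is found by moving one argument at a time, the symmetry of [D0]
    joining the two halves. *)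
Lemma C1_D0_diag (z : C) :
  regular z -> C1 (fun u => D0 u u) z (- E3 z z z + - E3 z z z).
Proof.
  intros Hz; destruct (regular_inv_bound z Hz) as [K [d [_ [Hd H]]]].
  exists (fun x y => - E3 x y x + - E3 x y y), d; split; [exact Hd|]; split; [easy|].
  intros x y Hx Hy; destruct (H x Hx) as [Rx _]; destruct (H y Hy) as [Ry _].
  split.
  - replace (D0 x x - D0 y y) with (D0 x x - D0 y x + (D0 x y - D0 y y))
      by (rewrite (D0_comm x y) by assumption; ring).
    rewrite !D0_minus by assumption; ring.
  - apply cont2_plus; apply cont2_opp, cont2_E3; try assumption;
      (apply cont2_fst || apply cont2_snd || apply cont2_const).
Qed.

Notation p := (weierstrass_p L).

Lemma weierstrass_p_D0 (z : C) : z <> 0 -> regular z -> p z = / z * / z + D0 z z.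
Proof.
  intros Hz0 Hz; unfold weierstrass_p; f_equal; [field; exact Hz0|].
  apply unordered_sum_eq.
  eapply is_unordered_sum_ext; [|exact (D0_sum z z Hz Hz)].
  intros x [Hx Hx0]; cbv beta; field; split; auto.
Qed.

(** A polarised ℘: on the diagonal it is ℘, and off it [- D u v] is the slope of ζ. One periodicity
    statement for [D] therefore serves both functions. *)
Definition D (u v : C) : C := / u * / v + D0 u v.

Lemma weierstrass_p_D (z : C) : ~ L z -> p z = D z z.
Proof.
  intros Hz; apply weierstrass_p_D0;
    [now apply not_lattice_neq_0|now apply regular_not_lattice].
Qed.

(* With the convention [/ 0 = 0] the point [0] of the lattice contributes the
   polar term of [D]. *)
Lemma D_sum (u v : C) :
  regular u -> regular v ->
  is_unordered_sum L (fun x => / (u + x) * / (v + x) - / x * / x) (D u v).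
Proof.
  intros Hu Hv.
  assert (H := is_unordered_sum_insert L L' 0 _ _ (lattice_0 w1 w2)
                 (fun x => iff_refl _) (D0_sum u v Hu Hv)).
  replace (D u v) with (D0 u v + (/ (u + 0) * / (v + 0) - / 0 * / 0)); [exact H|].
  unfold D; rewrite Cinv_0, !Cplus_0_r; ring.
Qed.

(* The defect [sum (1/(x + l)^2 - 1/x^2)] of periodicity is changed into its
   opposite by [x -> - x - l]. *)
Lemma D_period (u v l : C) :
  ~ L u -> ~ L v -> L l -> D (u + l) (v + l) = D u v.
Proof.
  intros Hu Hv Hl.
  assert (Hshift : forall z, ~ L z -> ~ L (z + l))
    by (intros z Hz H; apply Hz; now apply (lattice_shift w1 w2 l)).
  assert (S1 := is_unordered_sum_reindex L _ _ (fun x => x + l) (fun x => x - l)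
    (fun x Hx => lattice_plus w1 w2 x l Hx Hl)
    (fun x Hx => lattice_minus w1 w2 x l Hx Hl)
    ltac:(intros x; cbv beta; ring) ltac:(intros x; cbv beta; ring)
    (D_sum u v (regular_not_lattice u Hu) (regular_not_lattice v Hv))).
  assert (S2 := D_sum (u + l) (v + l) (regular_not_lattice _ (Hshift u Hu))
                  (regular_not_lattice _ (Hshift v Hv))).
  assert (S3 : is_unordered_sum L (fun x => / (x + l) * / (x + l) - / x * / x)
                 (D (u + l) (v + l) - D u v)).
  { eapply is_unordered_sum_ext; [|exact (is_unordered_sum_minus _ _ _ _ _ S2 S1)].
    intros x _; cbv beta.
    replace (u + l + x) with (u + (x + l)) by ring.
    replace (v + l + x) with (v + (x + l)) by ring. ring. }
  assert (Hinv : forall x, L x -> L (- x - l))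
    by (intros x Hx; apply lattice_minus; [now apply lattice_opp|exact Hl]).
  assert (S4 := is_unordered_sum_reindex L _ _ (fun x => - x - l) (fun x => - x - l)
    Hinv Hinv ltac:(intros x; cbv beta; ring) ltac:(intros x; cbv beta; ring) S3).
  (* Zero denominators do occur, since the sums run over the whole lattice; the convention [/ 0 = 0]
     respects the sign change. *)
  assert (Hsq : forall x : C, / (- x) * / (- x) = / x * / x).
  { intros x; destruct (classic (x = 0)) as [->|Hx].
    - replace (- (0)) with (RtoC 0) by ring; easy.
    - field; exact Hx. }
  assert (E : D (u + l) (v + l) - D u v = - (D (u + l) (v + l) - D u v)).
  { eapply is_unordered_sum_unique; [exact S4|].
    eapply is_unordered_sum_ext; [|exact (is_unordered_sum_opp _ _ _ S3)].
    intros x _; cbv beta.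
    replace (- x - l + l) with (- x) by ring.
    replace (- x - l) with (- (x + l)) by ring.
    rewrite !Hsq; ring. }
  set (s := D (u + l) (v + l) - D u v) in *.
  replace (D (u + l) (v + l)) with (s + D u v) by (unfold s; ring).
  replace s with ((s + s) / 2) by field.
  rewrite E at 1; field.
Qed.

(** The classical Weierstrass ζ: expanding [D0 u 0] gives 1/u + Σ (1/(u+x) - 1/x + u/x²). *)
Definition zeta (u : C) : C := / u - u * D0 u 0.

(** Termwise, u/((u+x)x) - v/((v+x)x) = (u-v)/((u+x)(v+x)), so the slope of ζ is exactly [- D].
    Hence ζ' = -℘ on the diagonal, and translation of ζ reduces to [D_period]. *)
Lemma zeta_minus (u v : C) :
  ~ L u -> ~ L v -> zeta u - zeta v = (u - v) * - D u v.
Proof.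
  intros Lu Lv.
  assert (Ru := regular_not_lattice u Lu); assert (Rv := regular_not_lattice v Lv).
  assert (H : u * D0 u 0 - v * D0 v 0 = (u - v) * D0 u v).
  { refine (is_unordered_sum_unique L' _ _ _ (is_unordered_sum_minus _ _ _ _ _
      (is_unordered_sum_scal _ u _ _ (D0_sum u 0 Ru regular_0))
      (is_unordered_sum_scal _ v _ _ (D0_sum v 0 Rv regular_0))) _).
    eapply is_unordered_sum_ext;
      [|exact (is_unordered_sum_scal _ (u - v) _ _ (D0_sum u v Ru Rv))].
    intros x [Hx Hx0]; cbv beta; rewrite !Cplus_0_l; field; repeat split; auto. }
  unfold zeta, D.
  transitivity (/ u - / v - (u * D0 u 0 - v * D0 v 0)); [ring|].
  rewrite H; field; split; now apply not_lattice_neq_0.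
Qed.

Lemma zeta_shift (u v l : C) :
  ~ L u -> ~ L v -> L l -> zeta (u + l) - zeta (v + l) = zeta u - zeta v.
Proof.
  intros Hu Hv Hl.
  assert (Hshift : forall z, ~ L z -> ~ L (z + l))
    by (intros z Hz H; apply Hz; now apply (lattice_shift w1 w2 l)).
  rewrite !zeta_minus, D_period by auto; ring.
Qed.

Lemma zeta_opp (u : C) : ~ L u -> zeta (- u) = - zeta u.
Proof.
  intros Hu; unfold zeta.
  assert (H := D0_opp u 0 (regular_not_lattice u Hu) regular_0).
  replace (- (0)) with (RtoC 0) in H by ring; rewrite H.
  field; now apply not_lattice_neq_0.
Qed.

Lemma weierstrass_p_opp (u : C) : ~ L u -> p (- u) = p u.
Proof.
  intros Hu; rewrite !weierstrass_p_D by (try apply not_lattice_opp; exact Hu).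
  unfold D; rewrite D0_opp by now apply regular_not_lattice.
  field; now apply not_lattice_neq_0.
Qed.

Lemma weierstrass_p_period (u l : C) : ~ L u -> L l -> p (u + l) = p u.
Proof.
  intros Hu Hl.
  rewrite !weierstrass_p_D by (try intros H; now apply Hu, (lattice_shift w1 w2 l)).
  now apply D_period.
Qed.

Lemma C1_D_l (z v : C) :
  z <> 0 -> regular z -> regular v -> exists d, C1 (fun u => D u v) z d.
Proof.
  intros Hz Rz Rv; eexists; unfold D.
  apply C1_plus; [|now apply C1_D0_l].
  apply C1_mult; [now apply C1_inv_id|apply C1_const].
Qed.

Lemma C1_weierstrass_p (z : C) : ~ L z -> C1 p z (weierstrass_p' L z).
Proof.
  intros Hz; destruct (not_lattice_near z Hz) as [r [Hr H]].
  assert (exists d, C1 p z d) as [d Hd].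
  { eexists; apply (C1_ext (fun u => / u * / u + D0 u u) _ z _ r Hr).
    - intros u Hu; symmetry; apply weierstrass_p_D, H, Hu.
    - assert (Hz0 := not_lattice_neq_0 z Hz).
      apply C1_plus; [apply C1_mult; now apply C1_inv_id|].
      now apply C1_D0_diag, regular_not_lattice. }
  unfold weierstrass_p'; now rewrite (C1_C_derive _ _ _ Hd).
Qed.

Lemma C1_zeta (z : C) : ~ L z -> C1 zeta z (- p z).
Proof.
  intros Hz; destruct (not_lattice_near z Hz) as [r [Hr H]].
  exists (fun u v => - D u v), r; split; [exact Hr|].
  split; [now rewrite weierstrass_p_D|].
  intros u v Hu Hv; specialize (H u Hu) as Lu; specialize (H v Hv) as Lv.
  split; [now apply zeta_minus|].
  apply cont2_opp, cont2_plus; [|apply cont2_D0; now apply regular_not_lattice].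
  apply cont2_mult; apply cont2_inv; try (now apply not_lattice_neq_0);
    (apply cont2_fst || apply cont2_snd).
Qed.

(** * The identity of Frobenius and Stickelberger *)

Definition zeta3 (z w : C) : C := zeta (z + w) - zeta z - zeta w.

(** As ζ is odd and ℘ even, its vanishing is the symmetric identity (ζ(a)+ζ(b)+ζ(c))² =
    ℘(a)+℘(b)+℘(c) for a+b+c = 0, taken at a = z+w, b = -z, c = -w. *)
Definition FS (z w : C) : C :=
  zeta3 z w * zeta3 z w - p (z + w) - p z - p w.

Lemma FS_period (z w l : C) :
  ~ L z -> ~ L (z + w) -> L l -> FS (z + l) w = FS z w.
Proof.
  intros Hz Hzw Hl; unfold FS, zeta3.
  replace (z + l + w) with (z + w + l) by ring.
  rewrite zeta_shift, (weierstrass_p_period (z + w) l), (weierstrass_p_period z l)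
    by assumption; reflexivity.
Qed.

(** The substitution only permutes the three arguments z+w, -z, -w. It carries the poles at [-w]
    plus the lattice to those at the lattice itself. *)
Lemma FS_reflect (z w : C) :
  ~ L z -> ~ L (z + w) -> FS (- (z + w)) w = FS z w.
Proof.
  intros Hz Hzw; unfold FS, zeta3.
  replace (- (z + w) + w) with (- z) by ring.
  rewrite !zeta_opp, !weierstrass_p_opp by assumption; ring.
Qed.

(** * Removal of the poles for fixed [w] *)

Section Entire.

Variable w : C.
Hypothesis HLw : ~ L w.

(* [FS _ w] with the polar terms at [0] cancelled. *)
Let B (z : C) : C := D0 z 0 - D (z + w) w.
Let FS0 (z : C) : C :=
  - (2 * B z) + z * z * (B z * B z) - p (z + w) - D0 z z - p w.

(** Here S = -1/z + z B(z). Squaring gives 1/z² - 2B + z²B², and the first term cancels the pole of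
    ℘(z) = 1/z² + D0(z,z). *)
Let FS_FS0 (z : C) : ~ L z -> ~ L (z + w) -> FS z w = FS0 z.
Proof.
  intros Hz Hzw; assert (Hz0 := not_lattice_neq_0 z Hz).
  assert (E : zeta3 z w = - / z + z * B z).
  { unfold zeta3, B.
    replace (zeta (z + w) - zeta z - zeta w) with (zeta (z + w) - zeta w - zeta z) by ring.
    rewrite zeta_minus by assumption; unfold zeta; ring. }
  unfold FS, FS0; rewrite E, (weierstrass_p_D z Hz); unfold D at 1; field; exact Hz0.
Qed.

(** Since B(0) = -℘(w), the term -2B contributes 2℘(w), which the two remaining copies of ℘(w)
    cancel. *)
Let FS0_0 : FS0 0 = 0.
Proof.
  unfold FS0, B; rewrite Cplus_0_l, D0_0, (weierstrass_p_D w HLw); ring.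
Qed.

Let C1_FS0 (z : C) : regular z -> ~ L (z + w) -> exists d, C1 FS0 z d.
Proof.
  intros Rz Hzw.
  assert (Rw := regular_not_lattice w HLw).
  assert (exists d, C1 B z d) as [b Hb].
  { destruct (C1_D_l (z + w) w) as [d Hd].
    - now apply not_lattice_neq_0.
    - now apply regular_not_lattice.
    - exact Rw.
    - eexists; apply C1_minus; [apply C1_D0_l; [exact Rz|apply regular_0]|].
      exact (C1_shift (fun u => D u w) z w d Hd). }
  eexists; unfold FS0.
  apply C1_minus; [|apply C1_const].
  apply C1_minus; [|exact (C1_D0_diag z Rz)].
  apply C1_minus; [|exact (C1_shift p z w _ (C1_weierstrass_p _ Hzw))].
  apply C1_plus.
  - apply C1_opp, C1_scal, Hb.
  - apply C1_mult; apply C1_mult; (exact Hb || apply C1_id).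
Qed.

(* The value [0] at the singular points is the one that makes [G] continuous. *)
Let G (z : C) : C :=
  if excluded_middle_informative (L z \/ L (z + w)) then 0 else FS z w.

Let G_FS0 (z : C) : regular z -> ~ L (z + w) -> G z = FS0 z.
Proof.
  intros Rz Hzw; unfold G; destruct excluded_middle_informative as [[Hz|H]|Hn].
  - replace z with (RtoC 0); [now rewrite FS0_0|].
    apply NNPP; intros Hne; apply (not_lattice_regular z Rz); congruence.
  - contradiction.
  - apply FS_FS0; tauto.
Qed.

Let lattice_shift_iff (z l : C) : L l -> (L (z + l) <-> L z).
Proof.
  intros Hl; split; intros H.
  - now apply (lattice_shift w1 w2 l).
  - now apply lattice_plus.
Qed.

Let G_period (l z : C) : L l -> G (z + l) = G z.
Proof.
  intros Hl; unfold G.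
  assert (H1 := lattice_shift_iff z l Hl).
  assert (H2 := lattice_shift_iff (z + w) l Hl).
  replace (z + w + l) with (z + l + w) in H2 by ring.
  do 2 destruct excluded_middle_informative; try tauto.
  apply FS_period; tauto.
Qed.

Let G_reflect (z : C) : G (- (z + w)) = G z.
Proof.
  assert (Hopp : forall x, L (- x) <-> L x).
  { intros x; split; intros H; [replace x with (- - x) by ring|];
      now apply lattice_opp. }
  unfold G.
  assert (H1 := Hopp (z + w)); assert (H2 := Hopp z).
  replace (- z) with (- (z + w) + w) in H2 by ring.
  do 2 destruct excluded_middle_informative; try tauto.
  apply FS_reflect; tauto.
Qed.

(** Near 0 and near points off the lattice, [G] coincides with [FS0]; any other lattice point is
    translated to 0 by periodicity. *)
Let C1_G_left (z : C) : ~ L (z + w) -> exists d, C1 G z d.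
Proof.
  intros Hzw.
  assert (Hreg : forall z, regular z -> ~ L (z + w) -> exists d, C1 G z d).
  { intros u Ru Huw; destruct (C1_FS0 u Ru Huw) as [d Hd]; exists d.
    destruct (regular_inv_bound u Ru) as [K [r [_ [Hr H]]]].
    destruct (not_lattice_near (u + w) Huw) as [s [Hs H']].
    apply (C1_ext FS0 G u d (Rmin r s)); [now apply Rmin_glb_lt| |exact Hd].
    intros x Hx; generalize (Rmin_l r s) (Rmin_r r s); intros.
    symmetry; apply G_FS0; [apply H; lra|apply H'].
    replace (x + w - (u + w)) with (x - u) by ring; lra. }
  destruct (classic (L z)) as [Hz|Hz].
  - destruct (Hreg 0 regular_0) as [d Hd]; [now rewrite Cplus_0_l|].
    exists d; apply (C1_ext (fun u => G (u + - z)) G z d 1 Rlt_0_1).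
    + intros u _; apply G_period; now apply lattice_opp.
    + apply C1_shift; now rewrite Cplus_opp_r.
  - apply Hreg; [now apply regular_not_lattice|exact Hzw].
Qed.

(** If z+w is a lattice point, the reflection moves [z] to the lattice point -(z+w). The previous
    case applies there, because -z = w - (z+w) is not in the lattice when [w] is not. *)
Let C1_G (z : C) : exists d, C1 G z d.
Proof.
  destruct (classic (L (z + w))) as [Hzw|Hzw]; [|now apply C1_G_left].
  destruct (C1_G_left (- (z + w))) as [d Hd].
  - replace (- (z + w) + w) with (- z) by ring; intros H; apply HLw.
    replace w with (- z + (z + w)) by ring; now apply lattice_plus.
  - exists (- (1) * d).
    apply (C1_ext (fun u => G (- (1) * u + - w)) G z _ 1 Rlt_0_1).
    + intros u _; rewrite <- (G_reflect u); f_equal; ring.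
    + apply C1_affine; replace (- (1) * z + - w) with (- (z + w)) by ring; exact Hd.
Qed.

Lemma FS_zero (z : C) : ~ L z -> ~ L (z + w) -> FS z w = 0.
Proof.
  intros Hz Hzw.
  destruct (periodic_continuous_bounded w1 w2 Hw G) as [M HM].
  - intros u eps He; destruct (C1_G u) as [d Hd].
    exact (C1_continuous G u d eps Hd He).
  - intros l u Hl; now apply G_period.
  - assert (H := liouville_C1 G M C1_G HM z).
    rewrite (G_FS0 0 regular_0), FS0_0 in H by now rewrite Cplus_0_l.
    rewrite <- H; unfold G; destruct excluded_middle_informative; tauto.
Qed.

End Entire.

(** [FS] vanishes on a whole neighbourhood of [z], so its derivative in [z] is zero; by ζ' = -℘, the
    derivative of S in [z] is ℘(z) - ℘(z+w). *)
Lemma FS_derive (z w : C) :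
  ~ L z -> ~ L w -> ~ L (z + w) ->
  2 * zeta3 z w * (p z - p (z + w))
  = weierstrass_p' L (z + w) + weierstrass_p' L z.
Proof.
  intros Hz HLw Hzw.
  assert (HS : C1 (fun u => zeta3 u w) z (- p (z + w) - - p z - 0)).
  { unfold zeta3; apply C1_minus; [|apply C1_const].
    apply C1_minus; [exact (C1_shift zeta z w _ (C1_zeta _ Hzw))|now apply C1_zeta]. }
  assert (H1 : C1 (fun u => FS u w) z
    ((- p (z + w) - - p z - 0) * zeta3 z w + zeta3 z w * (- p (z + w) - - p z - 0)
     - weierstrass_p' L (z + w) - weierstrass_p' L z - 0)).
  { unfold FS; apply C1_minus; [|apply C1_const].
    apply C1_minus; [|now apply C1_weierstrass_p].
    apply C1_minus; [|exact (C1_shift p z w _ (C1_weierstrass_p _ Hzw))].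
    exact (C1_mult _ _ _ _ _ HS HS). }
  destruct (not_lattice_near z Hz) as [r [Hr Hr']].
  destruct (not_lattice_near (z + w) Hzw) as [s [Hs Hs']].
  assert (H0 : C1 (fun u => FS u w) z 0).
  { apply (C1_ext (fun _ => 0) _ z 0 (Rmin r s)); [now apply Rmin_glb_lt| |apply C1_const].
    intros u Hu; generalize (Rmin_l r s) (Rmin_r r s); intros.
    symmetry; apply FS_zero; [exact HLw|apply Hr'; lra|apply Hs'].
    replace (u + w - (z + w)) with (u - z) by ring; lra. }
  assert (E := C1_unique _ _ _ _ H1 H0).
  set (X := weierstrass_p' L (z + w)) in *; set (Y := weierstrass_p' L z) in *.
  replace (X + Y) with (X + Y + 0) by ring; rewrite <- E; ring.
Qed.

End Weierstrass.

(** * Elimination of ζ between the two derived relations *)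

Theorem theorem4p2 (w1 w2 : C) (hw1 : w1 <> 0) (hw2 : w2 <> 0)
    (hw12 : ~ exists r : R, w1 / w2 = RtoC r) (z w : C) :
  let L := lattice w1 w2 in
  let p := weierstrass_p L in
  let p' := weierstrass_p' L in
  ~ L z -> ~ L w -> ~ L (z + w) -> p z <> p w ->
  p (w + z) = 1 / 4 * ((p' z - p' w) / (p z - p w)) ^ 2 - p z - p w.
Proof.
  intros L p p' Hz HLw Hzw Hp.
  (* The imaginary part of [w1 / w2] is minus this determinant over |w2|². *)
  assert (Hdet : (Re w1 * Im w2 - Im w1 * Re w2 <> 0)%R).
  { intros E; apply hw12; exists (Re (w1 / w2)).
    apply injective_projections; [reflexivity|].
    destruct w1 as [a b], w2 as [c d]; unfold Re, Im in *; simpl in *.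
    transitivity ((- (a * d - b * c)) / (c * (c * 1) + d * (d * 1)))%R;
      [unfold Rdiv; ring|rewrite E; unfold Rdiv; ring]. }
  assert (E1 := FS_derive w1 w2 Hdet z w Hz HLw Hzw).
  assert (Hwz : ~ L (w + z)) by now rewrite Cplus_comm.
  (* By the symmetry of [zeta3], exchanging [z] and [w] gives the relation obtained by
     differentiating in [w]; both contain ℘'(z+w), which drops out of their difference. *)
  assert (E2 := FS_derive w1 w2 Hdet w z HLw Hz Hwz).
  assert (E0 := FS_zero w1 w2 Hdet w HLw z Hz Hzw).
  fold L p p' in E1, E2; unfold FS in E0; fold L p in E0.
  replace (zeta3 w1 w2 w z) with (zeta3 w1 w2 z w) in E2
    by (unfold zeta3; rewrite (Cplus_comm w z); ring).
  rewrite (Cplus_comm w z) in E2 |- *.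
  set (S := zeta3 w1 w2 z w) in *.
  assert (Hpd : p z - p w <> 0).
  { intros E; apply Hp; replace (p z) with (p z - p w + p w) by ring.
    rewrite E; ring. }
  assert (E : p' z - p' w = 2 * S * (p z - p w)).
  { replace (p' z - p' w) with (p' (z + w) + p' z - (p' (z + w) + p' w)) by ring.
    rewrite <- E1, <- E2; ring. }
  rewrite E.
  replace (2 * S * (p z - p w) / (p z - p w)) with (2 * S) by (field; exact Hpd).
  replace (p (z + w)) with (p (z + w) + 0) by ring; rewrite <- E0; field.
Qed.
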